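(* For every $n\ge 1$ let $f_n:S_n\to\{0,1\}$ be a Boolean function, and let $d\ge 1$ be a fixed integer. Then: (1) If the sequence $\{f_{n^d}\}_{n=1}^\infty$ is noise sensitive with respect to the interchange process on the complete graph $K_{n^d}$, then it is noise sensitive with respect to the interchange process on the $d$-dimensional torus $\mathbb T_n^d$. (2) If the sequence $\{f_{n^d}\}_{n=1}^\infty$ is noise stable with respect to the interchange process on $\mathbb T_n^d$, then it is noise stable with respect to the interchange process on $K_{n^d}$.
   Context: $S_N$ is the group of permutations of $[N]=\{1,\dots,N\}$ under composition. Graphs: $K_N$ has vertex set $[N]$ and all pairs as edges. The discrete torus $\mathbb T_n^d$ has vertex set $\mathbb Z_n^d$ ($\mathbb Z_n$ the integers modulo $n$) and edge set $\{\{x,y\}: x\neq y,\ x-y\in\{\pm e_1,\dots,\pm e_d\}\}$, where $e_j$ is the $j$th standard unit vector. Its $N=n^d$ vertices are labelled by $1,\dots,N$ (any fixed labelling), so that its edges become pairs $\{i,j\}\subset[N]$. Interchange process: for a connected graph on $[N]$ with edge set $E$, the interchange process is the continuous-time Markov chain on $S_N$ with generator $(Qf)(\pi)=\nu\sum_{\{i,j\}\in E}\big(f(\pi\,(i,j))-f(\pi)\big)$, where $(i,j)$ is the transposition and $\nu>0$ is a constant rate (the same for all edges). It is reversible and irreducible with uniform stationary distribution. Relaxation time: for a reversible irreducible continuous-time Markov chain on a finite state space with generator $Q$, $t_{\rm rel}=1/\theta_1$, where $\theta_1$ is the smallest positive eigenvalue of $-Q$. Noise sensitivity/stability: let $X_n(t)$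 be reversible irreducible continuous-time Markov chains on finite sets $\Omega_n$ with stationary distributions $\pi_n$ and relaxation times $t^n_{\rm rel}$, started from $X_n(0)\sim\pi_n$. A sequence $g_n:\Omega_n\to\{0,1\}$ is noise sensitive with respect to these chains if for all $\alpha>0$, $\lim_{n\to\infty}\mathrm{Cov}\big(g_n(X_n(0)),g_n(X_n(\alpha t^n_{\rm rel}))\big)=0$. It is noise stable if $\lim_{\alpha\to0}\sup_n\mathbb P\big(g_n(X_n(0))\ne g_n(X_n(\alpha t^n_{\rm rel}))\big)=0$. Here $\Omega_n=S_{n^d}$ and $g_n=f_{n^d}$. If $\Omega_n$ is a single point (here $n=1$), the covariance and the probability are both $0$, and $t^n_{\rm rel}$ may be given any value. *)

(* Defs.v *)
From HB Require Import structures.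
From mathcomp Require Import all_boot all_order all_algebra all_fingroup.
From mathcomp Require Import all_classical all_reals all_analysis.

Set Implicit Arguments.
Unset Strict Implicit.
Unset Printing Implicit Defensive.

Import Order.TTheory GRing.Theory Num.Theory.
Import numFieldNormedType.Exports.

Local Open Scope classical_set_scope.
Local Open Scope ring_scope.

Section MarkovChains.
Variables (R : realType) (Omega : finType).
Implicit Types (Q : (Omega -> R) -> Omega -> R) (pi : Omega -> R).

Definition semigroup Q (t : R) (f : Omega -> R) (x : Omega) : R :=
  limn (series (fun k => exp_coeff t k * iter k Q f x)).

Definition transition Q (t : R) (x y : Omega) : R :=
  semigroup Q t (fun z => (z == y)%:R) x.

Definition is_eigenvalue_opp Q (theta : R) : Prop :=
  exists f : Omega -> R,
    (exists x, f x != 0) /\ forall x, - Q f x = theta * f x.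

(* The spectrum is finite, so the infimum is a minimum whenever a positive
   eigenvalue exists; if there is none (e.g. Omega is a single point),
   [inf set0 = 0] and the value is [0^-1 = 0]. *)
Definition relaxation_time Q : R :=
  (inf [set theta | 0 < theta /\ is_eigenvalue_opp Q theta])^-1.

Definition uniform_law : Omega -> R := fun=> #|Omega|%:R^-1.

(* A continuous-time Markov chain on a finite state space, specified by its
   finite-dimensional distributions; no path regularity is required.
   Only the values of the process at times [t >= 0] matter. *)
Record markov_chain Q pi := MarkovChain {
  mc_disp : measure_display;
  mc_space : measurableType mc_disp;
  mc_prob : probability mc_space R;
  mc_proc :> R -> mc_space -> Omega;
  mc_measurable : forall (t : R) (x : Omega), 0 <= t ->
    measurable (mc_proc t @^-1` [set x]);
  mc_fdd : forall (k : nat) (t : nat -> R) (x : nat -> Omega),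
    t 0%N = 0 -> (forall i, t i <= t i.+1) ->
    mc_prob (\bigcap_(i < k.+1) (mc_proc (t i) @^-1` [set x i]))
    = (pi (x 0%N) *
       \prod_(0 <= i < k) transition Q (t i.+1 - t i) (x i) (x i.+1))%:E }.

End MarkovChains.

Unset Implicit Arguments.

Section Noise.
Variables (R : realType) (Omega : nat -> finType).
Variables (Q : forall n, (Omega n -> R) -> Omega n -> R).
Variables (pi : forall n, Omega n -> R).
Variables (X : forall n, markov_chain (Q n) (pi n)).
Variables (g : forall n, Omega n -> bool).

Definition noise_sensitive : Prop :=
  forall alpha : R, 0 < alpha ->
    (fun n => covariance (mc_prob (X n))
       (fun w => (g n (X n 0 w))%:R)
       (fun w => (g n (X n (alpha * relaxation_time (Q n)) w))%:R)) @ \oo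
    --> 0%E.

Definition disagreement (alpha : R) (n : nat) : \bar R :=
  mc_prob (X n)
    [set w | g n (X n 0 w) != g n (X n (alpha * relaxation_time (Q n)) w)].

Definition noise_stable : Prop :=
  ereal_sup (range (disagreement alpha)) @[alpha --> 0^'+] --> 0%E.

End Noise.

Arguments noise_sensitive {R Omega Q pi} X g.
Arguments disagreement {R Omega Q pi} X g alpha n.
Arguments noise_stable {R Omega Q pi} X g.

Set Implicit Arguments.

Section Interchange.
Variable (R : realType).

(* With permutations multiplied as functions, [s (i,j)] is
   [s \o tperm i j]; MathComp multiplies permutations in the opposite order,
   so it is [tperm i j * s].
   Each edge {i,j} is counted once, as the pair with [i < j]. *)
Definition interchange_generator (N : nat) (adj : rel 'I_N) (nu : R)
    (f : 'S_N -> R) (s : 'S_N) : R :=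
  nu * \sum_(p : 'I_N * 'I_N | (p.1 < p.2)%N && adj p.1 p.2)
         (f (tperm p.1 p.2 * s)%g - f s).

(* The process is started from its stationary distribution. *)
Definition interchange_process (N : nat) (adj : rel 'I_N) (nu : R) :=
  markov_chain (interchange_generator adj nu) (@uniform_law R 'S_N).

End Interchange.

Definition complete_adj (N : nat) : rel 'I_N := fun i j => i != j.

(* Z_n^d for n = m.+1: the additive group ['I_m.+1] is Z_(m+1) also when
   m = 0, unlike ['Z_1]. *)
Definition torus_vertex (m d : nat) := {ffun 'I_d -> 'I_m.+1}.

Definition unit_vector (m d : nat) (j : 'I_d) : torus_vertex m d :=
  [ffun i => if i == j then inZp 1 else 0].

Definition torus_adj (m d : nat) : rel (torus_vertex m d) := fun x y =>
  (x != y) && [exists j : 'I_d,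
    (x - y == unit_vector m j) || (x - y == - unit_vector m j)].

Definition labelled_torus_adj (m d : nat)
    (lab : 'I_(m.+1 ^ d) -> torus_vertex m d) : rel 'I_(m.+1 ^ d) :=
  relpre lab (@torus_adj m d).

(* Main.v *)
Require Import Defs.
From mathcomp Require Import all_boot all_order all_algebra all_fingroup.
From mathcomp Require Import all_classical all_reals all_analysis.
From mathcomp Require spectral sesquilinear complex.
From mathcomp Require Import ring lra.

(** The two chains have comparable Dirichlet forms once each is run at the speed
    of its own relaxation time, and such a comparison moves noise sensitivity
    one way and noise stability the other way.

    Write E_K and E_T for the Dirichlet forms of the interchange process on the
    complete graph and on the torus with N = n^d vertices, and t_K, t_T for the
    relaxation times.  The central estimate is [energy_comparison]:
        t_K E_K(f) <= (48 d)^2 t_T E_T(f)   for every f on S_N,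
    with a constant that does not depend on n or on the rates.  It has three
    ingredients.
    - [transposition_poincare]: a Poincare inequality for random transpositions
      that is sharp up to a factor 4, so that t_K <= 4 / (nu_K N).  It is
      proved by induction on the set of positions that are being shuffled:
      averaging over all permutations of A splits as averaging over those that
      fix k, after averaging over one transposition (k, a), and the point k is
      itself averaged over A.
    - [torus_comparison]: the variation of f along a transposition (x, x+v),
      summed over x, behaves like the square of a norm of v, because
      (x, x+v+w) is a conjugate of (x, x+v) by (x+v, x+v+w).  Hence going from
      unit vectors to arbitrary v costs only a factor of order n^2, and
      E_K <= C n^2 N E_T up to the rates.  The translation invariance of the sum
      over x replaces the usual count of canonical paths.
    - [relaxation_torus]: t_T is at least of order n^2 / nu_T.  A single
      particle of the interchange process performs a simple random walk, and
      the cosine of its first coordinate has a small Rayleigh quotient.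

    The transfer from E_K to E_T of sensitivity is not a comparison of the
    semigroups themselves, since the exponential is not operator monotone.
    If v = P_T f is f smoothed by the torus semigroup, then t_T E_T(v), and
    hence t_K E_K(v), is at most a constant times |f|^2.  Therefore v barely
    moves under a short run of the complete-graph semigroup P_K, and
        <f, P_T f> = <f, v> is close to <P_K f, v>,
    which is small when f is noise sensitive for the complete graph
    ([sensitivity_transfer]).  In the other direction, if f is stable for the
    torus then f is close to v, whose complete-graph energy is bounded, so v,
    and with it f, changes little under P_K ([stability_transfer]).  The few
    facts on semigroups that this uses all follow from the expansion of a
    function in eigenfunctions of a self-adjoint generator. *)

Set Implicit Arguments.
Unset Strict Implicit.
Unset Printing Implicit Defensive.

Import Order.TTheory GRing.Theory Num.Theory.
Import numFieldNormedType.Exports.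
Local Open Scope classical_set_scope.
Local Open Scope ring_scope.

(** * Eigenfunction expansions of self-adjoint operators *)

Section SymmetricMatrices.
Import spectral sesquilinear complex.

(** A real symmetric matrix is unitarily diagonalizable over the complex numbers
    with real eigenvalues, and real parts of complex eigenvectors for a real
    eigenvalue are again eigenvectors (or zero). *)
Lemma symmetric_mx_eigenrows (R : rcfType) n (M : 'M[R]_n) : M^T = M ->
  exists lam : 'I_n -> R, forall f : 'rV[R]_n, exists u : 'I_n -> 'rV[R]_n,
    f = \sum_i u i /\ forall i, u i *m M = lam i *: u i.
Proof.
move=> Msym; pose Mc := map_mx (real_complex R) M.
have Mc_herm : Mc \is hermsymmx.
  apply/is_hermitianmxP; rewrite expr0 scale1r; apply/matrixP => i j.
  by rewrite !mxE conj_Creal ?complex_real// -[in LHS]Msym mxE.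
have /orthomx_spectralP := hermitian_normalmx Mc_herm.
have /mxOverP D_real := hermitian_spectral_diag_real Mc_herm.
have Punit := spectral_unit Mc.
move: (spectralmx Mc) (spectral_diag Mc) Punit D_real => P D Punit D_real McE.
pose re (v : 'rV[R[i]]_n) : 'rV[R]_n := \row_j complex.Re (v 0 j).
have reD (v w : 'rV[R[i]]_n) : re (v + w) = re v + re w.
  by apply/rowP => j; rewrite !mxE raddfD.
have re0 : re 0 = 0 by apply/rowP => j; rewrite !mxE.
have re_mul (v : 'rV[R[i]]_n) : re (v *m Mc) = re v *m M.
  apply/rowP => j; rewrite !mxE raddf_sum; apply: eq_bigr => k _.
  by rewrite !mxE; case: (v 0 k) => a b; rewrite /= mulr0 subr0.
exists (fun i => complex.Re (D 0 i)) => f.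
pose c := map_mx (real_complex R) f *m invmx P.
exists (fun i => re (c 0 i *: row i P)); split.
  have -> : f = re (map_mx (real_complex R) f).
    by apply/rowP => j; rewrite !mxE.
  rewrite -[map_mx _ f](mulmxKV Punit) mulmx_sum_row.
  by apply: (big_morph re).
move=> i; rewrite -re_mul.
have -> : (c 0 i *: row i P) *m Mc = D 0 i *: (c 0 i *: row i P).
  rewrite -scalemxAl McE !mulmxA -row_mul mulmxV// -row_mul mul1mx.
  rewrite row_diag_mx -scalemxAl -rowE.
  by rewrite !scalerA mulrC.
have ReZ (k : R) z : complex.Re (real_complex R k * z) = k * complex.Re z.
  by case: z => a b /=; rewrite mul0r subr0.
have /complex_realP[k Dk] := D_real 0 i.
by apply/rowP => j; rewrite [LHS]mxE [in LHS]mxE Dk ReZ !mxE.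
Qed.

End SymmetricMatrices.

Section Inner.
Variables (R : realType) (T : finType).
Implicit Types (f g h : T -> R) (Q : (T -> R) -> T -> R).

Definition inner f g : R := \sum_x f x * g x.

Lemma innerC f g : inner f g = inner g f.
Proof. by apply: eq_bigr => x _; rewrite mulrC. Qed.

Lemma innerDl f g h : inner (f + g) h = inner f h + inner g h.
Proof. by rewrite -big_split; apply: eq_bigr => x _; rewrite /= mulrDl. Qed.

Lemma innerZl a f h : inner (a *: f) h = a * inner f h.
Proof. by rewrite mulr_sumr; apply: eq_bigr => x _; rewrite mulrA. Qed.

Lemma innerDr f g h : inner h (f + g) = inner h f + inner h g.
Proof. by rewrite !(innerC h) innerDl. Qed.

Lemma innerZr a f h : inner h (a *: f) = a * inner h f.
Proof. by rewrite !(innerC h) innerZl. Qed.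

Lemma innerNl f h : inner (- f) h = - inner f h.
Proof. by rewrite -scaleN1r innerZl mulN1r. Qed.

Lemma innerNr f h : inner h (- f) = - inner h f.
Proof. by rewrite !(innerC h) innerNl. Qed.

Lemma inner0l h : inner 0 h = 0.
Proof. by apply: big1 => x _; rewrite mul0r. Qed.

Lemma inner_suml I (r : seq I) (u : I -> T -> R) h :
  inner (\sum_(i <- r) u i) h = \sum_(i <- r) inner (u i) h.
Proof.
by apply: (big_morph (inner^~ h)) => [f g|]; rewrite ?innerDl ?inner0l.
Qed.

Lemma inner_sumr I (r : seq I) (u : I -> T -> R) h :
  inner h (\sum_(i <- r) u i) = \sum_(i <- r) inner h (u i).
Proof. by rewrite innerC inner_suml; apply: eq_bigr => i _; rewrite innerC. Qed.

Lemma inner_ge0 f : 0 <= inner f f.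
Proof. by apply: sumr_ge0 => x _; rewrite -expr2 sqr_ge0. Qed.

Lemma inner_eq0 f : inner f f = 0 -> f = 0.
Proof.
move=> /eqP; rewrite psumr_eq0 => [/allP f0|x _]; last by rewrite -expr2 sqr_ge0.
apply/funext => x; have /= := f0 x (mem_index_enum x).
by rewrite mulf_eq0 orbb => /eqP.
Qed.

Definition self_adjoint Q := forall f g, inner (Q f) g = inner f (Q g).

(** The eigencomponent [u l] is indexed by the eigenvalue itself, of -Q, so that
    components with different indices are orthogonal, and expansions of two
    functions share the same index list. *)
Lemma spectral_decomposition Q : linear Q -> self_adjoint Q ->
  exists2 s : seq R, uniq s & forall f, exists2 u : R -> T -> R,
    f = \sum_(l <- s) u l & forall l, Q (u l) = (- l) *: u l.
Proof.
move=> Qlin Qsym.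
have Q0 : Q 0 = 0.
  by have := Qlin (-1) 0 0; rewrite scaler0 addr0 scaleN1r addNr.
have Qsum I (r : seq I) (P : pred I) (u : I -> T -> R) :
    Q (\sum_(i <- r | P i) u i) = \sum_(i <- r | P i) Q (u i).
  by apply: (big_morph Q) => // f g; have := Qlin 1 f g; rewrite !scale1r.
have QZ a f : Q (a *: f) = a *: Q f by have := Qlin a f 0; rewrite Q0 !addr0.
pose vec f : 'rV[R]_#|T| := \row_i f (enum_val i).
pose fn (v : 'rV[R]_#|T|) : T -> R := fun x => v 0 (enum_rank x).
have vecK f : fn (vec f) = f.
  by apply/funext => x; rewrite /fn mxE enum_rankK.
have fn_sum (u : 'I_#|T| -> 'rV[R]_#|T|) (P : pred 'I_#|T|) :
    fn (\sum_(i | P i) u i) = \sum_(i | P i) fn (u i).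
  by apply/funext => x; rewrite /fn summxE fct_sumE.
(* A row vector lists the values of a function; M acts on rows as Q. *)
pose del (x : T) : T -> R := fun y => (y == x)%:R.
have innerdel f x : inner f (del x) = f x.
  rewrite /inner (bigD1 x)//= /del eqxx mulr1 big1 ?addr0// => y /negPf->.
  by rewrite mulr0.
pose M : 'M[R]_#|T| := \matrix_(i, j) Q (del (enum_val i)) (enum_val j).
have MT : M^T = M.
  by apply/matrixP => i j; rewrite !mxE -innerdel Qsym innerC innerdel.
have fnM v : fn (v *m M) = Q (fn v).
  have -> : fn v = \sum_i v 0 i *: del (enum_val i).
    apply/funext => y; rewrite fct_sumE (bigD1 (enum_rank y))//= big1 ?addr0.
      by rewrite /del enum_rankK !fctE eqxx /= /GRing.scale/= mulr1.
    move=> i iy; rewrite !fctE /del; case: eqP => [yi|_]; last exact: mulr0.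
    by rewrite yi enum_valK eqxx in iy.
  apply/funext => x; rewrite /fn mxE Qsum fct_sumE; apply: eq_bigr => i _.
  by rewrite QZ mxE enum_rankK.
have [lam decomp] := symmetric_mx_eigenrows MT.
exists (undup [seq - lam i | i <- enum 'I_#|T|]); first exact: undup_uniq.
move=> f; have [u [fu uM]] := decomp (vec f).
exists (fun l => \sum_(i | - lam i == l) fn (u i)).
  rewrite -[LHS]vecK fu fn_sum.
  rewrite (exchange_big_dep xpredT)//=; apply: eq_bigr => i _.
  rewrite (eq_bigl (pred1 (- lam i))) => [|l]; last by rewrite eq_sym.
  rewrite -big_filter filter_pred1_uniq ?big_seq1 ?undup_uniq// mem_undup.
  by apply/mapP; exists i; rewrite ?mem_enum.
move=> l; rewrite Qsum scaler_sumr; apply: eq_bigr => i /eqP <-.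
by rewrite -fnM uM opprK; apply/funext => x; rewrite /fn mxE.
Qed.
End Inner.

(** * The semigroup of a self-adjoint generator *)

Section Heat.
Variables (R : realType) (T : finType) (Q : (T -> R) -> T -> R).
Hypotheses (Qlin : linear Q) (Qsym : self_adjoint Q).
Implicit Types (f g h : T -> R) (s : seq R) (u v : R -> T -> R) (a b : R -> R).

Definition energy f := - inner f (Q f).

Let Qsum I (r : seq I) (u : I -> T -> R) :
  Q (\sum_(i <- r) u i) = \sum_(i <- r) Q (u i).
Proof.
apply: (big_morph Q) => [f g|]; first by have := Qlin 1 f g; rewrite !scale1r.
by have := Qlin (-1) 0 0; rewrite scaler0 addr0 scaleN1r addNr.
Qed.

Let QZ (c : R) f : Q (c *: f) = c *: Q f.
Proof.
have := Qlin c f 0; have := Qlin (-1) 0 0.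
by rewrite scaler0 addr0 scaleN1r addNr => ->; rewrite !addr0.
Qed.

Lemma eigen_orthogonal k l f g : Q f = (- k) *: f -> Q g = (- l) *: g ->
  k != l -> inner f g = 0.
Proof.
move=> Qf Qg kl; have := Qsym f g; rewrite Qf Qg innerZl innerZr => /eqP.
rewrite -subr_eq0 -mulrBl mulf_eq0 opprK addrC subr_eq0.
by rewrite eq_sym (negPf kl) => /eqP.
Qed.

Lemma inner_expansion s u v a b : uniq s ->
  (forall l, Q (u l) = (- l) *: u l) -> (forall l, Q (v l) = (- l) *: v l) ->
  inner (\sum_(l <- s) a l *: u l) (\sum_(l <- s) b l *: v l)
  = \sum_(l <- s) a l * b l * inner (u l) (v l).
Proof.
move=> us Qu Qv; rewrite inner_suml; apply: eq_big_seq => l ls.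
rewrite inner_sumr (bigD1_seq l)//= innerZl innerZr big1 ?addr0 ?mulrA//.
move=> k kl; rewrite innerZl innerZr (eigen_orthogonal (Qu l) (Qv k)) ?mulr0//.
by rewrite eq_sym.
Qed.

Lemma iter_expansion s u k : (forall l, Q (u l) = (- l) *: u l) ->
  iter k Q (\sum_(l <- s) u l) = \sum_(l <- s) (- l) ^+ k *: u l.
Proof.
move=> Qu; elim: k => [|k IH].
  by apply: eq_bigr => l _; rewrite expr0 scale1r.
rewrite iterS IH Qsum; apply: eq_bigr => l _.
by rewrite QZ Qu scalerA exprSr.
Qed.

Lemma semigroup_expansion s u t : (forall l, Q (u l) = (- l) *: u l) ->
  semigroup Q t (\sum_(l <- s) u l) = \sum_(l <- s) expR (- (t * l)) *: u l.
Proof.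
move=> Qu; apply/funext => x; rewrite /semigroup; apply/cvg_lim => //.
rewrite [X in X @ _](_ : _ =
    fun n => \sum_(l <- s) series (exp_coeff (- (t * l))) n * u l x); last first.
  apply/funext => n; rewrite /series/= -[RHS]/(\sum_(l <- s) _).
  under [RHS]eq_bigr do rewrite mulr_suml.
  rewrite exchange_big/=; apply: eq_bigr => k _.
  rewrite iter_expansion// fct_sumE mulr_sumr; apply: eq_bigr => l _.
  rewrite /exp_coeff/= -mulrN exprMn.
  by rewrite -[((- l) ^+ k *: u l) x]/((- l) ^+ k * u l x); ring.
rewrite fct_sumE; elim: (s) => [|l s' IH].
  by rewrite big_nil; under eq_fun do rewrite big_nil; exact: cvg_cst.
rewrite big_cons; under eq_fun do rewrite big_cons.
apply: cvgD IH; apply: cvgMl; exact: is_cvg_series_exp_coeff.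
Qed.

Lemma semigroup_linear t : linear (semigroup Q t).
Proof.
have [s _ dec] := spectral_decomposition Qlin Qsym.
move=> c f g; have [u fE Qu] := dec f; have [v gE Qv] := dec g.
have -> : c *: f + g = \sum_(l <- s) (c *: u l + v l).
  by rewrite big_split -scaler_sumr -fE -gE.
rewrite semigroup_expansion => [|l]; last first.
  by rewrite Qlin Qu Qv scalerDr !scalerA mulrC.
rewrite fE gE !semigroup_expansion// scaler_sumr -big_split.
by apply: eq_bigr => l _; rewrite scalerDr !scalerA mulrC.
Qed.

Lemma semigroup_sym t : self_adjoint (semigroup Q t).
Proof.
have [s us dec] := spectral_decomposition Qlin Qsym.
move=> f g; have [u fE Qu] := dec f; have [v gE Qv] := dec g.
have sum1 (w : R -> T -> R) : \sum_(l <- s) w l = \sum_(l <- s) 1 *: w l.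
  by apply: eq_bigr => l _; rewrite scale1r.
rewrite fE gE !semigroup_expansion// [in LHS](sum1 v) [in RHS](sum1 u).
by rewrite !inner_expansion//; apply: eq_bigr => l _; rewrite mulr1 mul1r.
Qed.

Lemma semigroup_fixed t f : Q f = 0 -> semigroup Q t f = f.
Proof.
(* f is its own expansion, with 0 as the only eigenvalue. *)
move=> Qf; pose u (l : R) : T -> R := if l == 0 then f else 0.
have Qu l : Q (u l) = (- l) *: u l.
  rewrite /u; case: eqP => [->|_]; first by rewrite oppr0 scale0r.
  by rewrite scaler0 -[X in Q X](scale0r 0) QZ scale0r.
have := semigroup_expansion [:: 0] t Qu.
by rewrite !big_seq1 mulr0 oppr0 expR0 scale1r /u eqxx.
Qed.

Hypothesis Qneg : forall f, 0 <= energy f.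

(** The spectral measure of f: weights on the spectrum of -Q from which every
    quadratic quantity in f below is read off, so that the inequalities that
    follow reduce to inequalities between functions of one eigenvalue. *)
Lemma spectral_measure f : exists s (w : R -> R), [/\
  forall l, 0 <= w l, forall l, l < 0 -> w l = 0,
  inner f f = \sum_(l <- s) w l, energy f = \sum_(l <- s) l * w l &
  forall t, [/\ inner f (semigroup Q t f) = \sum_(l <- s) expR (- (t * l)) * w l,
   inner (semigroup Q t f) (semigroup Q t f)
     = \sum_(l <- s) expR (- (t * l)) ^+ 2 * w l &
   energy (semigroup Q t f) = \sum_(l <- s) l * expR (- (t * l)) ^+ 2 * w l]].
Proof.
have [s us dec] := spectral_decomposition Qlin Qsym; have [u fE Qu] := dec f.
have f1 : f = \sum_(l <- s) 1 *: u l.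
  by rewrite {1}fE; apply: eq_bigr => l _; rewrite scale1r.
have Qexp a : Q (\sum_(l <- s) a l *: u l) = \sum_(l <- s) (- l * a l) *: u l.
  by rewrite Qsum; apply: eq_bigr => l _; rewrite QZ Qu scalerA mulrC.
have PE t : semigroup Q t f = \sum_(l <- s) expR (- (t * l)) *: u l.
  by rewrite {1}fE semigroup_expansion.
exists s, (fun l => inner (u l) (u l)); split=> [l|l l0|||t].
- exact: inner_ge0.
- apply/eqP; rewrite eq_le inner_ge0 andbT.
  have := Qneg (u l); rewrite /energy Qu innerZr mulNr opprK.
  by rewrite nmulr_rge0.
- rewrite f1 inner_expansion//.
  by apply: eq_bigr => l _; rewrite !mul1r.
- rewrite /energy f1 (Qexp (fun=> 1)) inner_expansion// -sumrN.
  by apply: eq_bigr => l _; rewrite mul1r mulr1 mulNr opprK.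
- rewrite /energy PE {1}f1 !Qexp !inner_expansion// -sumrN.
  by split; apply: eq_bigr => l _; ring.
Qed.

(** Smoothing: x exp(-2x) <= 1 for x = t l. *)
Lemma energy_semigroup_le t f : 0 <= t ->
  t * energy (semigroup Q t f) <= inner f f.
Proof.
move=> t0; have [s [w [w0 wneg -> _ /(_ t) [_ _ ->]]]] := spectral_measure f.
rewrite mulr_sumr; apply: ler_sum => l _; rewrite 2!mulrA -[leRHS]mul1r.
have [l0|l0] := ltP l 0; first by rewrite wneg// !mulr0.
apply: ler_wpM2r => //; rewrite -expRM_natl mulrN expRN.
rewrite ler_pdivrMr ?expR_gt0// mul1r.
apply: (le_trans _ (expR_ge1Dx _)).
have : 0 <= t * l by exact: mulr_ge0.
rewrite -[2%:R]/2; lra.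
Qed.

(** (1 - exp(-x))^2 <= x for x = t l >= 0. *)
Lemma sub_semigroup_le_energy t f : 0 <= t ->
  inner (f - semigroup Q t f) (f - semigroup Q t f) <= t * energy f.
Proof.
move=> t0; rewrite innerDl !innerDr !innerNl !innerNr opprK.
have [s [w [w0 wneg ff -> /(_ t)[fP PP _]]]] := spectral_measure f.
rewrite (innerC (semigroup _ _ _) f) ff fP PP mulr_sumr.
rewrite -!sumrN -!big_split/=; apply: ler_sum => l _.
have [l0|l0] := ltP l 0; first by rewrite wneg// !mulr0 oppr0 !addr0.
have tl : 0 <= t * l by exact: mulr_ge0.
have e1 := expR_ge1Dx (- (t * l)); have e0 := expR_gt0 (- (t * l)).
have el : expR (- (t * l)) <= 1 by rewrite -expR0 ler_expR oppr_le0.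
rewrite mulrA.
move: (expR _) e1 e0 el tl (w0 l) => e; move: (t * l) (w l) => x y e1 e0 el x0 y0.
rewrite -subr_ge0 [leRHS](_ : _ = (x - (1 - e) ^+ 2) * y); last by ring.
by apply: mulr_ge0 => //; nra.
Qed.

Lemma sub_semigroup_le_inner t f : 0 <= t ->
  inner (f - semigroup Q t f) (f - semigroup Q t f)
  <= inner f (f - semigroup Q t f).
Proof.
move=> t0; rewrite innerDl !innerDr !innerNl !innerNr opprK.
have [s [w [w0 wneg ff _ /(_ t)[fP PP _]]]] := spectral_measure f.
rewrite (innerC (semigroup _ _ _) f) ff fP PP.
rewrite -!sumrN -!big_split/=; apply: ler_sum => l _.
have [l0|l0] := ltP l 0; first by rewrite wneg// !mulr0 oppr0 !addr0.
have el : expR (- (t * l)) <= 1 by rewrite -expR0 ler_expR oppr_le0 mulr_ge0.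
have e0 := expR_gt0 (- (t * l)).
move: (expR _) e0 el (w0 l) => e; move: (w l) => y e0 el y0.
rewrite -subr_ge0 [leRHS](_ : _ = e * (1 - e) * y); last by ring.
by rewrite !mulr_ge0 ?subr_ge0// ltW.
Qed.

Lemma inner_sub_semigroup_le_energy t f : 0 <= t ->
  inner f (f - semigroup Q t f) <= t * energy f.
Proof.
move=> t0; rewrite innerDr innerNr.
have [s [w [w0 wneg -> -> /(_ t)[-> _ _]]]] := spectral_measure f.
rewrite mulr_sumr -sumrN -big_split/=; apply: ler_sum => l _.
have := expR_ge1Dx (- (t * l)); have := w0 l.
move: (expR _) => e; rewrite mulrA; move: (t * l) (w l) => x y y0 e1.
rewrite -subr_ge0 [leRHS](_ : _ = (x - (1 - e)) * y); last by ring.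
by apply: mulr_ge0 => //; lra.
Qed.

Lemma inner_sub_semigroup_le t f : inner f (f - semigroup Q t f) <= inner f f.
Proof.
rewrite innerDr innerNr gerDl oppr_le0.
have [s [w [w0 _ _ _ /(_ t)[-> _ _]]]] := spectral_measure f.
by apply: sumr_ge0 => l _; rewrite mulr_ge0// expR_ge0.
Qed.

Lemma inner_sub_semigroup_ge0 t f : 0 <= t ->
  0 <= inner f (f - semigroup Q t f).
Proof.
by move=> t0; apply: le_trans (sub_semigroup_le_inner f t0); exact: inner_ge0.
Qed.

Lemma semigroup_contraction t f : 0 <= t ->
  inner (semigroup Q t f) (semigroup Q t f) <= inner f f.
Proof.
move=> t0; have [s [w [w0 wneg -> _ /(_ t)[_ -> _]]]] := spectral_measure f.
apply: ler_sum => l _; rewrite -[leRHS]mul1r.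
have [l0|l0] := ltP l 0; first by rewrite wneg// !mulr0.
apply: ler_wpM2r => //; rewrite expr_le1 ?expR_ge0//.
by rewrite -expR0 ler_expR oppr_le0 mulr_ge0.
Qed.

Lemma inner_semigroup_double t f :
  inner f (semigroup Q (2 * t) f) = inner (semigroup Q t f) (semigroup Q t f).
Proof.
have [s [w [_ _ _ _ Pf]]] := spectral_measure f.
have [-> _ _] := Pf (2 * t); have [_ -> _] := Pf t.
by apply: eq_bigr => l _; rewrite -expRM_natl -mulrA mulrN.
Qed.

(** The parallelogram law for the nonnegative quadratic form <f, f - P_t f>. *)
Lemma inner_sub_semigroup_split t g h : 0 <= t ->
  inner (g + h) ((g + h) - semigroup Q t (g + h))
  <= 2 * inner g (g - semigroup Q t g) + 2 * inner h (h - semigroup Q t h).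
Proof.
move=> t0; have P1 := semigroup_linear t 1 g h.
have P2 := semigroup_linear t (-1) h g.
rewrite !(scale1r, scaleN1r) in P1 P2.
have := inner_sub_semigroup_ge0 (- h + g) t0.
rewrite P1 P2 !(innerDl, innerDr, innerNl, innerNr); lra.
Qed.

End Heat.

(** * Covariances and disagreement probabilities of a stationary chain *)

Section Chain.
Variables (R : realType) (T : finType) (Q : (T -> R) -> T -> R).
Hypotheses (Qlin : linear Q) (Qsym : self_adjoint Q).
Hypothesis Q1 : Q (fun=> 1) = 0.
Variable X : markov_chain Q (@uniform_law R T).

Lemma sum_transition t f x :
  \sum_y transition Q t x y * f y = semigroup Q t f x.
Proof.
pose del (y : T) : T -> R := fun z => (z == y)%:R.
have Plin := semigroup_linear Qlin Qsym t.
have PD (g h : T -> R) : semigroup Q t (g + h) = semigroup Q t g + semigroup Q t h.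
  by have := Plin 1 g h; rewrite !scale1r.
have P0 : semigroup Q t 0 = 0.
  by have := Plin (-1) 0 0; rewrite scaler0 addr0 scaleN1r addNr.
have {2}-> : f = \sum_y f y *: del y.
  apply/funext => z; rewrite fct_sumE (bigD1 z)//= big1 ?addr0.
    by rewrite /del !fctE eqxx /= /GRing.scale/= mulr1.
  by move=> y yz; rewrite !fctE /del eq_sym (negPf yz); exact: mulr0.
rewrite (big_morph _ PD P0) fct_sumE; apply: eq_bigr => y _.
by have := Plin (f y) (del y) 0; rewrite P0 !addr0 => ->; rewrite mulrC.
Qed.

Let pair_eventE t (r : rel T) : [set w | r (X 0 w) (X t w)]
  = \bigcup_(p in [set p : T * T | r p.1 p.2])
      (X 0 @^-1` [set p.1] `&` X t @^-1` [set p.2]).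
Proof.
apply/seteqP; split => [w rw|w [[x y] /= rxy [/= -> ->]]//].
by exists (X 0 w, X t w).
Qed.

Lemma measurable_pair_event t (r : rel T) : 0 <= t ->
  measurable [set w | r (X 0 w) (X t w)].
Proof.
move=> t0; rewrite pair_eventE.
apply: fin_bigcup_measurable => [|p _]; first exact: finite_finset.
by apply: measurableI; apply: mc_measurable.
Qed.

Lemma prob_pair_event t (r : rel T) : 0 <= t ->
  mc_prob X [set w | r (X 0 w) (X t w)]
  = (#|T|%:R^-1 * \sum_x \sum_y transition Q t x y * (r x y)%:R)%:E.
Proof.
move=> t0; rewrite pair_eventE measure_fin_bigcup; last first.
- by move=> p _; apply: measurableI; apply: mc_measurable.
- by move=> [x y] [x' y'] _ _ /= [w [[/= <- <-] [/= <- <-]]].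
- exact: finite_finset.
transitivity (\sum_(p : T * T | r p.1 p.2)
    (#|T|%:R^-1 * transition Q t p.1 p.2)%:E)%E.
  rewrite (_ : [set p | _] = [set` [seq p <- enum {: T * T} | r p.1 p.2]]).
  - rewrite -fsbig_seq ?filter_uniq -?enumT ?enum_uniq// big_filter big_enum_cond/=.
    apply: eq_bigr => -[x y] _ /=.
    (* The finite-dimensional law at the two times 0 and t. *)
    have := @mc_fdd _ _ _ _ X 1%N (fun i => if i == 0%N then 0 else t)
      (fun i => if i == 0%N then x else y) erefl.
    rewrite big_nat1/= subr0 /uniform_law => <-; last by case.
    congr (mc_prob X _); apply/seteqP; split => w /=.
      by move=> [w0 wt] [|[|]].
    by move=> w01; split; [exact: (w01 0%N)|exact: (w01 1%N)].
  - by apply/seteqP; split=> p /=; rewrite mem_filter mem_enum andbT.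
rewrite sumEFin; congr EFin.
rewrite -mulr_sumr; congr (_ * _); rewrite big_mkcond pair_bigA/=.
by apply: eq_bigr => -[x y] _ /=; case: r; rewrite ?mulr1 ?mulr0.
Qed.

Lemma prob_product_event t (a b : T -> bool) : 0 <= t ->
  mc_prob X [set w | a (X 0 w) && b (X t w)]
  = (#|T|%:R^-1 * inner (fun x => (a x)%:R) (semigroup Q t (fun x => (b x)%:R)))%:E.
Proof.
move=> t0; rewrite (prob_pair_event (fun x y => a x && b y) t0).
congr (_ * _)%:E; apply: eq_bigr => x _; rewrite -sum_transition mulr_sumr.
apply: eq_bigr => y _.
by case: (a x); case: (b y); rewrite ?(mulr1, mul1r, mulr0, mul0r).
Qed.

(** Centering f removes the product of the means, because the semigroup fixes
    constants and the uniform law is stationary. *)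
Lemma covariance_chain t (g : T -> bool) (f := fun x => (g x)%:R : R)
    (f0 := f - (fun=> #|T|%:R^-1 * inner f (fun=> 1))) : (0 < #|T|)%N -> 0 <= t ->
  covariance (mc_prob X) (fun w => f (X 0 w)) (fun w => f (X t w))
  = (#|T|%:R^-1 * inner f0 (semigroup Q t f0))%:E.
Proof.
move=> T_gt0 t0; pose A := [set w | g (X 0 w)]; pose B := [set w | g (X t w)].
have P1 : semigroup Q t (fun=> 1) = fun=> 1 by exact: semigroup_fixed.
have AE : A = [set w | g (X 0 w) && xpredT (X t w)].
  by apply/seteqP; split => w /=; rewrite andbT.
have mA : measurable A.
  rewrite AE; exact: (measurable_pair_event (fun x y => g x && xpredT y) t0).
have mB : measurable B.
  exact: (measurable_pair_event (fun x y => xpredT x && g y) t0).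
have PA : mc_prob X A = (#|T|%:R^-1 * inner f (fun=> 1))%:E.
  by rewrite AE (prob_product_event g xpredT t0) P1.
have PB : mc_prob X B = (#|T|%:R^-1 * inner f (fun=> 1))%:E.
  rewrite (_ : B = [set w | xpredT (X 0 w) && g (X t w)])//.
  rewrite (prob_product_event xpredT g t0).
  by rewrite -(semigroup_sym Qlin Qsym) P1 innerC.
have PAB : mc_prob X (A `&` B) = (#|T|%:R^-1 * inner f (semigroup Q t f))%:E.
  rewrite -(prob_product_event g g t0); congr (mc_prob X _).
  by apply/seteqP; split => w /=; [case=> -> ->|move=> /andP].
have indicA : (fun w => f (X 0 w)) = \1_A.
  by apply/funext => w; rewrite indicE mem_setE.
have indicB : (fun w => f (X t w)) = \1_B.
  by apply/funext => w; rewrite indicE mem_setE.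
have Lindic E : measurable E -> (\1_E : _ -> R) \in Lfun (mc_prob X) 1.
  by move=> mE; apply/Lfun1_integrable; exact: integrable_indic.
have ABE : (\1_A * \1_B = \1_(A `&` B) :> (_ -> R)).
  by apply/funext => w; rewrite indicI.
rewrite indicA indicB covarianceE ?ABE ?Lindic//; last exact: measurableI.
rewrite !expectation_indic//; last exact: measurableI.
rewrite PA PB PAB -EFinM -EFinB; congr EFin.
have cst c : (fun=> c) = c *: (fun=> 1) :> (T -> R).
  by apply/funext => x; rewrite !fctE; exact/esym/mulr1.
have n0 : #|T|%:R != 0 :> R by rewrite pnatr_eq0 -lt0n.
have inner11 : inner (fun _ : T => 1) (fun=> 1) = #|T|%:R :> R.
  by rewrite -sumr_const; apply: eq_bigr => x _; rewrite mulr1.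
have f1 : inner (fun=> 1) (semigroup Q t f) = inner f (fun=> 1).
  by rewrite -(semigroup_sym Qlin Qsym) P1 innerC.
have Pf0 : semigroup Q t f0
    = semigroup Q t f - (#|T|%:R^-1 * inner f (fun=> 1)) *: (fun=> 1).
  have := semigroup_linear Qlin Qsym t (- (#|T|%:R^-1 * inner f (fun=> 1)))
    (fun=> 1) f.
  rewrite P1 scaleNr [RHS]addrC => <-; congr semigroup.
  by rewrite /f0 [X in f - X]cst addrC -scaleNr.
rewrite Pf0 /f0 [X in f - X]cst.
rewrite !(innerDl, innerDr, innerNl, innerNr, innerZl, innerZr).
by rewrite f1 inner11; field.
Qed.

(** For bits a and b, the indicator of a != b is a + b - 2 a b; the two linear
    terms both sum to |f|^2 since f is Boolean and the law is stationary. *)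
Lemma prob_disagreement t (g : T -> bool) (f := fun x => (g x)%:R : R) : 0 <= t ->
  mc_prob X [set w | g (X 0 w) != g (X t w)]
  = (2 * #|T|%:R^-1 * inner f (f - semigroup Q t f))%:E.
Proof.
move=> t0; rewrite (prob_pair_event (fun x y => g x != g y) t0); congr EFin.
rewrite [2 * _]mulrC -mulrA; congr (_ * _).
have P1 : semigroup Q t (fun=> 1) = fun=> 1 by exact: semigroup_fixed.
have f1 : inner (fun=> 1) (semigroup Q t f) = inner f (fun=> 1).
  by rewrite -(semigroup_sym Qlin Qsym) P1 innerC.
have ff : inner f f = inner f (fun=> 1).
  by apply: eq_bigr => x _; rewrite /f; case: (g x); rewrite ?mulr1 ?mul0r.
transitivity (inner f (semigroup Q t (fun=> 1)) + inner (fun=> 1) (semigroup Q t f)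
    - 2 * inner f (semigroup Q t f)); last first.
  by rewrite innerDr innerNr ff f1 P1; ring.
rewrite /inner -big_split mulr_sumr -sumrB; apply: eq_bigr => x _ /=.
rewrite -!sum_transition !mulr_sumr -big_split -sumrB; apply: eq_bigr => y _ /=.
by rewrite /f; case: (g x); case: (g y) => /=; ring.
Qed.

End Chain.

(** * A Poincare inequality for random transpositions *)

Lemma sqr_sum_le (R : realFieldType) (I : finType) (P : pred I) (a : I -> R) :
  (\sum_(i | P i) a i) ^+ 2 <= #|P|%:R * \sum_(i | P i) a i ^+ 2.
Proof.
have [P0|P0] := eqVneq (#|P|%:R : R) 0.
  rewrite P0 mul0r big_pred0 ?expr0n// => i.
  by move/eqP: P0; rewrite pnatr_eq0 => /eqP/card0_eq/(_ i).
set S := \sum_(i | P i) a i; set n : R := #|P|%:R in P0 *.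
have n_gt0 : 0 < n by rewrite lt_def P0 /n ler0n.
have : 0 <= \sum_(i | P i) (a i - S / n) ^+ 2.
  by apply: sumr_ge0 => i _; exact: sqr_ge0.
have -> : \sum_(i | P i) (a i - S / n) ^+ 2
    = \sum_(i | P i) a i ^+ 2 - S ^+ 2 / n.
  under eq_bigr do rewrite sqrrB.
  rewrite big_split sumrB/= sumr_const.
  have -> : \sum_(i | P i) a i * (S / n) *+ 2 = S * (S / n) *+ 2.
    by rewrite sumrMnl -mulr_suml.
  by rewrite -mulr_natl -/n; field.
by rewrite subr_ge0 ler_pdivrMr// mulrC.
Qed.

Section Permutations.
Variables (R : realType) (N : nat).
Implicit Types (f h : 'S_N -> R) (A B : {set 'I_N}).

Definition swap_variation f (i j : 'I_N) : R :=
  \sum_s (f (tperm i j * s)%g - f s) ^+ 2.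

Lemma swap_variation_ge0 f i j : 0 <= swap_variation f i j.
Proof. by apply: sumr_ge0 => s _; exact: sqr_ge0. Qed.

Lemma swap_variationC f i j : swap_variation f i j = swap_variation f j i.
Proof. by rewrite /swap_variation tpermC. Qed.

Lemma swap_variationxx f i : swap_variation f i i = 0.
Proof. by apply: big1 => s _; rewrite tperm1 mul1g subrr expr0n. Qed.

(** The orthogonal projection onto the functions that are invariant under all
    permutations supported on A. *)
Definition perm_avg A f (s : 'S_N) : R :=
  #|[pred p : 'S_N | perm_on A p]|%:R^-1 * \sum_(p | perm_on A p) f (p * s)%g.

Lemma card_perm_on_neq0 A : #|[pred p : 'S_N | perm_on A p]|%:R != 0 :> R.
Proof.
by rewrite pnatr_eq0 -lt0n; apply/card_gt0P; exists 1%g; rewrite inE perm_on1.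
Qed.

Lemma perm_on_mulr A (p r : 'S_N) :
  perm_on A r -> perm_on A (p * r)%g = perm_on A p.
Proof.
move=> Ar; apply/idP/idP => [Apr|Ap]; last exact: perm_onM.
by rewrite -(mulgK r p); apply: perm_onM => //; rewrite perm_onV.
Qed.

Lemma perm_on_mull A (p r : 'S_N) :
  perm_on A r -> perm_on A (r * p)%g = perm_on A p.
Proof.
move=> Ar; apply/idP/idP => [Apr|Ap]; last exact: perm_onM.
by rewrite -(mulKg r p); apply: perm_onM => //; rewrite perm_onV.
Qed.

Lemma perm_avg_mull A f r s :
  perm_on A r -> perm_avg A f (r * s)%g = perm_avg A f s.
Proof.
move=> Ar; congr (_ * _); rewrite [RHS](reindex_inj (mulIg r))/=.
by apply: eq_big => p; [rewrite perm_on_mulr|rewrite mulgA].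
Qed.

Lemma perm_avgB A f h s : perm_avg A (f - h) s = perm_avg A f s - perm_avg A h s.
Proof. by rewrite -mulrBr -sumrB. Qed.

Lemma inner_perm_avg A f h : (forall r s, perm_on A r -> h (r * s)%g = h s) ->
  inner (perm_avg A f) h = inner f h.
Proof.
move=> hA; rewrite /inner; under eq_bigr do rewrite -mulrA mulr_suml.
rewrite -mulr_sumr exchange_big/= (eq_bigr (fun=> inner f h)) => [|p Ap].
  by rewrite sumr_const -[X in _ * X]mulr_natl mulKf// card_perm_on_neq0.
rewrite /inner [RHS](reindex_inj (mulgI p))/=.
by apply: eq_bigr => s _; rewrite hA.
Qed.

(** Jensen's inequality for the average over permutations, together with the
    invariance of the counting measure. *)
Lemma perm_avg_contraction A f : inner (perm_avg A f) (perm_avg A f) <= inner f f.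
Proof.
set c : R := #|[pred p : 'S_N | perm_on A p]|%:R.
have c0 : 0 < c by rewrite lt_def card_perm_on_neq0 ler0n.
have : \sum_s c * perm_avg A f s ^+ 2
    <= \sum_s \sum_(p | perm_on A p) f (p * s)%g ^+ 2.
  apply: ler_sum => s _.
  have -> : c * perm_avg A f s ^+ 2
      = c^-1 * (\sum_(p | perm_on A p) f (p * s)%g) ^+ 2.
    by rewrite /perm_avg -/c; field; exact: lt0r_neq0.
  rewrite ler_pdivrMl//; exact: sqr_sum_le.
rewrite -mulr_sumr exchange_big/= [leRHS](eq_bigr (fun=> inner f f)) => [|p Ap].
  rewrite sumr_const -[leRHS]mulr_natl -/c ler_pM2l//.
rewrite /inner [RHS](reindex_inj (mulgI p))/=.
by apply: eq_bigr.
Qed.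

(** Coset decomposition: a permutation p supported on A is uniquely the product
    of a transposition (k, a), with p a = k, and a permutation of A that
    fixes k. *)
Lemma sum_perm_on A k (F : 'S_N -> R) : k \in A ->
  \sum_(p | perm_on A p) F p
  = \sum_(a in A) \sum_(p | perm_on (A :\ k) p) F (tperm k a * p)%g.
Proof.
move=> kA.
rewrite (partition_big (fun p : 'S_N => p^-1%g k) (mem A)) /=; last first.
  by move=> p Ap; have := perm_closed k (perm_onV Ap); rewrite kA.
apply: eq_bigr => a aA; rewrite (reindex_inj (mulgI (tperm k a)))/=.
apply: eq_bigl => p.
have tA : perm_on A (tperm k a).
  apply: fintype.subset_trans (tperm_on k a) _.
  by rewrite finset.subUset !finset.sub1set kA.
rewrite perm_on_mull// invMg tpermV permM.
rewrite -[X in _ == X](tpermL k a) (inj_eq perm_inj).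
apply/andP/fintype.subsetP => [[/fintype.subsetP Ap /eqP pk] x xp|Ap].
  rewrite !inE Ap// andbT; apply: contraNneq xp => ->.
  by rewrite -{1}pk permKV.
split; first by apply/fintype.subsetP => x /Ap; rewrite !inE => /andP[].
apply: contraT => pk; suff /Ap : k \in [pred x | p x != x] by rewrite !inE eqxx.
by apply: contraNN pk => /eqP {1}<-; rewrite permK.
Qed.

Lemma card_perm_on_setD1 A k : k \in A ->
  #|[pred p : 'S_N | perm_on A p]|%:R
  = #|A|%:R * #|[pred p : 'S_N | perm_on (A :\ k) p]|%:R :> R.
Proof.
move=> kA; have := sum_perm_on (fun=> 1) kA; rewrite !sumr_const => ->.
by rewrite mulr_natl.
Qed.

Definition swap_avg A k f (s : 'S_N) : R :=
  #|A|%:R^-1 * \sum_(a in A) f (tperm k a * s)%g.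

Lemma perm_avg_setD1 A k f : k \in A ->
  perm_avg A f = perm_avg (A :\ k) (swap_avg A k f).
Proof.
move=> kA; apply/funext => s; rewrite /perm_avg (card_perm_on_setD1 kA).
rewrite (sum_perm_on _ kA) invfM /swap_avg -mulr_sumr mulrA [in RHS](mulrC _^-1).
congr (_ * _); rewrite exchange_big/=.
by apply: eq_bigr => p _; apply: eq_bigr => a _; rewrite mulgA.
Qed.

Lemma inner_swap_avg_sub A k f : k \in A ->
  inner (f - swap_avg A k f) (f - swap_avg A k f)
  <= #|A|%:R^-1 * \sum_(a in A) swap_variation f k a.
Proof.
move=> kA; have A0 : 0 < #|A|%:R :> R by rewrite ltr0n; apply/card_gt0P; exists k.
rewrite [in leRHS]exchange_big/= mulr_sumr; apply: ler_sum => s _.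
have -> : (f - swap_avg A k f) s
    = - (#|A|%:R^-1 * \sum_(a in A) (f (tperm k a * s)%g - f s)).
  rewrite sumrB mulrBr sumr_const -[f s *+ _]mulr_natl mulKf ?gt_eqF//.
  by rewrite opprB.
rewrite mulrNN mulrACA -mulrA -expr2 ler_pM2l ?invr_gt0// ler_pdivrMl//.
exact: sqr_sum_le.
Qed.

(** The difference between the projections for A minus k and for A is the
    former projection applied to f minus its average over the swaps (k, a);
    it is orthogonal to the residual of f for A minus k. *)
Lemma perm_avg_pythagoras A k f : k \in A ->
  inner (f - perm_avg A f) (f - perm_avg A f)
  <= inner (f - perm_avg (A :\ k) f) (f - perm_avg (A :\ k) f)
     + #|A|%:R^-1 * \sum_(a in A) swap_variation f k a.
Proof.
move=> kA; set B := A :\ k; set h := perm_avg B f - perm_avg A f.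
have -> : f - perm_avg A f = (f - perm_avg B f) + h by rewrite addrA subrK.
have hE : h = perm_avg B (f - swap_avg A k f).
  by apply/funext => s; rewrite perm_avgB -perm_avg_setD1.
have ortho : inner (f - perm_avg B f) h = 0.
  rewrite innerDl innerNl inner_perm_avg ?subrr// => r s Br.
  by rewrite hE perm_avg_mull.
clearbody h; move: (f - perm_avg B f) ortho => g ortho.
rewrite innerDl !innerDr [inner h g]innerC ortho addr0 add0r lerD2l.
rewrite hE; apply: le_trans (perm_avg_contraction _ _) _.
exact: inner_swap_avg_sub.
Qed.

Lemma perm_avg_set0 f : perm_avg finset.set0 f = f.
Proof.
apply/funext => s; rewrite /perm_avg.
have on0 (p : 'S_N) : perm_on finset.set0 p = (p == 1%g).
  apply/idP/eqP => [/fintype.subsetP p0|->]; last exact: perm_on1.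
  apply/permP => x; rewrite perm1; apply: contraTeq isT => px.
  by have := p0 x px; rewrite finset.in_set0.
rewrite (eq_bigl _ _ on0) big_pred1_eq mul1g.
rewrite (_ : #|_| = 1%N) ?invr1 ?mul1r//.
by rewrite -(card1 (1%g : 'S_N)); apply: eq_card => p; rewrite !inE on0.
Qed.

(** Induction on the size of A, in which [perm_avg_pythagoras] is averaged over
    the removed point k; averaging is what gives the factor [#|A|], as each pair
    {i, j} survives the removal of k for all but two choices of k. *)
Lemma subset_poincare A f :
  #|A|%:R * inner (f - perm_avg A f) (f - perm_avg A f)
  <= \sum_(i in A) \sum_(j in A) swap_variation f i j.
Proof.
move: {2}#|A| (erefl #|A|) => m; elim: m A => [|m IH] A Am.
  rewrite Am mul0r; apply: sumr_ge0 => i _; apply: sumr_ge0 => j _.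
  exact: swap_variation_ge0.
set S := leRHS; set V := inner _ _.
pose V' k := inner (f - perm_avg (A :\ k) f) (f - perm_avg (A :\ k) f).
pose S' k := \sum_(i in A :\ k) \sum_(j in A :\ k) swap_variation f i j.
have step : #|A|%:R * V <= \sum_(k in A) V' k + #|A|%:R^-1 * S.
  rewrite /S [in leRHS]mulr_sumr -big_split/= mulr_natl -sumr_const.
  apply: ler_sum => k kA; exact: perm_avg_pythagoras.
have cardD k : k \in A -> #|A :\ k| = m.
  by move=> kA; move: Am; rewrite (cardsD1 k) kA => -[].
have IH' : m%:R * \sum_(k in A) V' k <= \sum_(k in A) S' k.
  rewrite mulr_sumr; apply: ler_sum => k kA.
  by rewrite -(cardD _ kA); apply: IH; exact: cardD.
(* The pairs lost on removing k are those that contain k. *)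
have sumS' : \sum_(k in A) S' k = m%:R * S - S.
  have rowS k : k \in A -> S' k = S - 2 * \sum_(j in A) swap_variation f k j.
    move=> kA; have rest : \sum_(i in A :\ k) \sum_(j in A) swap_variation f i j
        = \sum_(j in A) swap_variation f k j + S' k.
      rewrite (big_setD1 k kA)/= swap_variationxx add0r -big_split/=.
      by apply: eq_bigr => i _; rewrite (big_setD1 k kA)/= swap_variationC.
    by rewrite /S (big_setD1 k kA)/= rest; ring.
  rewrite (eq_bigr _ rowS) sumrB sumr_const -mulr_sumr -/S Am.
  by rewrite -[S *+ _]mulr_natl -natr1; ring.
have S0 : 0 <= S.
  by apply: sumr_ge0 => i _; apply: sumr_ge0 => j _; exact: swap_variation_ge0.
rewrite {}sumS' in IH'; case: m => [|m] in Am cardD IH' IH *.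
  have V0 k : k \in A -> V' k = 0.
    move=> kA; rewrite /V' (cards0_eq (cardD k kA)) perm_avg_set0 subrr.
    exact: inner0l.
  by move: step; rewrite (eq_bigr _ V0) big1// add0r Am invr1 mul1r.
apply: (le_trans step); rewrite Am.
have m0 : 0 <= m%:R :> R by [].
rewrite -!natr1 in IH' *; move: (\sum_(k in A) V' k) IH' => v IH'.
rewrite -ler_pdivlMl in IH'; last by rewrite ltr_wpDl.
apply: (le_trans (lerD IH' (lexx _))); rewrite -subr_ge0.
rewrite [leRHS](_ : _ = S * (m%:R + 1)^-1 * (m%:R + 1 + 1)^-1); last first.
  by field; rewrite !lt0r_neq0// ?ltr_wpDl// addr_ge0.
by rewrite !mulr_ge0// invr_ge0 !addr_ge0.
Qed.

(** The case where A is everything, for which the average is the mean. *)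
Lemma transposition_poincare f : \sum_s f s = 0 ->
  N%:R * inner f f <= \sum_i \sum_j swap_variation f i j.
Proof.
move=> f0; have := subset_poincare [set: 'I_N] f; rewrite cardsT card_ord.
have -> : perm_avg [set: 'I_N] f = 0.
  apply/funext => s; rewrite /perm_avg (eq_bigl xpredT) => [|p]; last first.
    by apply/fintype.subsetP => i _; rewrite finset.in_setT.
  by move: f0; rewrite (reindex_inj (mulIg s)) => ->; rewrite mulr0.
rewrite subr0 => /le_trans; apply; rewrite (eq_bigl _ _ (@finset.in_setT _)).
by apply: ler_sum => i _; rewrite (eq_bigl _ _ (@finset.in_setT _)).
Qed.
End Permutations.

(** * Generator and Dirichlet form of the interchange process *)

Section Interchange.
Variables (R : realType) (N : nat) (adj : rel 'I_N) (nu : R).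
Implicit Types f g : 'S_N -> R.
Local Notation Q := (interchange_generator adj nu).

Lemma interchange_linear : linear Q.
Proof.
move=> c f g; apply/funext => s; rewrite /interchange_generator.
rewrite -[RHS]/(c * (nu * _) + nu * _) mulrCA -mulrDr; congr (_ * _).
rewrite mulr_sumr -big_split; apply: eq_bigr => p _ /=.
by rewrite -![(_ *: f + g) _]/(c * f _ + g _); ring.
Qed.

Lemma interchange_const : Q (fun=> 1) = 0.
Proof.
apply/funext => s; rewrite /interchange_generator big1 ?mulr0// => p _.
exact: subrr.
Qed.

(** Summation by parts: s |-> (i j) s is an involution of S_N, so the sum over s
    of (f (t s) - f s) g s changes sign when g s is replaced by g (t s). *)
Lemma inner_interchange f g : inner (Q f) g
  = - (nu / 2) * \sum_(p : 'I_N * 'I_N | (p.1 < p.2)%N && adj p.1 p.2)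
     \sum_s (f (tperm p.1 p.2 * s)%g - f s) * (g (tperm p.1 p.2 * s)%g - g s).
Proof.
rewrite /inner /interchange_generator.
under eq_bigr do rewrite -mulrA mulr_suml.
rewrite -mulr_sumr exchange_big/= mulNr -mulrN -mulrA; congr (_ * _).
rewrite -sumrN mulr_sumr; apply: eq_bigr => p _.
set t := tperm _ _; set S := LHS.
have -> : \sum_s (f (t * s)%g - f s) * (g (t * s)%g - g s) = - (2 * S).
  transitivity (\sum_s (f (t * s)%g - f s) * g (t * s)%g - S).
    by rewrite -sumrB; apply: eq_bigr => s _; rewrite mulrBr.
  rewrite (reindex_inj (mulgI t))/=.
  under eq_bigr do rewrite !mulgA tperm2 mul1g -opprB mulNr.
  by rewrite sumrN -/S; ring.
by rewrite opprK mulrA mulVf ?mul1r// pnatr_eq0.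
Qed.

Lemma interchange_sym : self_adjoint Q.
Proof.
move=> f g; rewrite [RHS]innerC !inner_interchange; congr (_ * _).
by apply: eq_bigr => p _; apply: eq_bigr => s _; rewrite mulrC.
Qed.

(** The sum is over ordered pairs: every edge is counted twice. *)
Definition edge_variation f : R :=
  \sum_(p : 'I_N * 'I_N | adj p.1 p.2) swap_variation f p.1 p.2.

Lemma edge_variation_ge0 f : 0 <= edge_variation f.
Proof. by apply: sumr_ge0 => p _; exact: swap_variation_ge0. Qed.

Lemma energy_interchange f : symmetric adj -> irreflexive adj ->
  energy Q f = nu / 4 * edge_variation f.
Proof.
move=> adjC adjxx; rewrite /energy innerC inner_interchange mulNr opprK.
set S := \sum_(p | _) _.
have SE : S = \sum_(p : 'I_N * 'I_N | (p.1 < p.2)%N && adj p.1 p.2)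
    swap_variation f p.1 p.2 by [].
suff -> : edge_variation f = S + S by field.
rewrite {2}SE (reindex_inj (h := fun p : 'I_N * 'I_N => (p.2, p.1)))/=; last first.
  by case=> [a b] [c d] [-> ->].
rewrite SE /edge_variation (bigID (fun p : 'I_N * 'I_N => (p.1 < p.2)%N))/=.
congr (_ + _); first by apply: eq_bigl => p; rewrite andbC.
apply: eq_big => [[i j]|[i j] _] /=; last by rewrite swap_variationC.
rewrite -leqNgt leq_eqVlt adjC andbC.
by case: (eqVneq (j : nat) i) => [/val_inj ->|//]; rewrite adjxx !andbF.
Qed.

Lemma interchange_neg f : 0 <= nu -> symmetric adj -> irreflexive adj ->
  0 <= energy Q f.
Proof.
move=> nu0 adjC adjxx; rewrite energy_interchange//.
by rewrite mulr_ge0 ?divr_ge0// edge_variation_ge0.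
Qed.

Lemma sum_eigenfunction f theta : theta != 0 -> (forall s, - Q f s = theta * f s) ->
  \sum_s f s = 0.
Proof.
move=> theta0 Qf; apply: (mulfI theta0); rewrite mulr0 mulr_sumr.
under eq_bigr do rewrite -Qf; rewrite sumrN.
have := interchange_sym f (fun=> 1); rewrite interchange_const [RHS]innerC inner0l.
by rewrite /inner; under eq_bigr do rewrite mulr1; move=> ->; rewrite oppr0.
Qed.

(** An eigenfunction for a nonzero eigenvalue has mean zero, so a Poincare
    inequality for mean-zero functions bounds every positive eigenvalue. *)
Lemma eigenvalue_ge c theta : symmetric adj -> irreflexive adj ->
  (forall g, \sum_s g s = 0 -> c * inner g g <= nu / 4 * edge_variation g) ->
  0 < theta -> is_eigenvalue_opp Q theta -> c <= theta.
Proof.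
move=> adjC adjxx gap theta0 [g [[s gs] Qg]].
have gg : 0 < inner g g.
  rewrite lt_def inner_ge0 andbT; apply: contra_neq gs => /inner_eq0 ->.
  by [].
rewrite -(ler_pM2r gg); apply: le_trans (gap g _) _.
  by apply: sum_eigenfunction Qg; rewrite gt_eqF.
rewrite -energy_interchange// /energy /inner -sumrN mulr_sumr.
by apply: ler_sum => x _; rewrite -mulrN Qg mulrCA.
Qed.

End Interchange.

(** * Comparison of the torus with the complete graph *)

Lemma sqr_add3_le (R : realFieldType) (K a b c : R) : 0 < K ->
  (a + b + c) ^+ 2 <= (K + 2) * (a ^+ 2 / K + b ^+ 2 + c ^+ 2).
Proof.
move=> K0; have -> : a = K * (a / K) by rewrite mulrCA mulfV ?mulr1// gt_eqF.
move: (a / K) => x; rewrite exprMn [K ^+ 2]expr2 mulrAC mulfK ?gt_eqF//.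
rewrite -subr_ge0 [leRHS](_ : _ = K * (x - b) ^+ 2 + K * (x - c) ^+ 2
  + (b - c) ^+ 2); last by ring.
by rewrite !addr_ge0 ?sqr_ge0//; apply: mulr_ge0; rewrite ?sqr_ge0// ltW.
Qed.

(** The triangle inequality for the square root of [swap_variation], up to a
    factor 2, in squared form: (i k) = (j k)(i j)(j k), and the two factors
    (j k) contribute equally.  The weight K lets the inequality be iterated
    along a path without an exponential loss. *)
Lemma swap_variation_triangle (R : realType) N (f : 'S_N -> R)
    (i j k : 'I_N) (K : R) :
  0 < K ->
  swap_variation f i k
  <= (K + 2) * (swap_variation f i j / K + 2 * swap_variation f j k).
Proof.
move=> K0; have sv0 := swap_variation_ge0 f.
have K2 : 0 <= K + 2 by rewrite addr_ge0// ltW.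
have [->|ij] := eqVneq i j.
  rewrite swap_variationxx mul0r add0r mulrA ler_peMl//; nra.
have [<-|jk] := eqVneq j k.
  rewrite swap_variationxx mulr0 addr0 mulrA mulrAC ler_peMl//.
  by rewrite ler_pdivlMr// mul1r lerDl.
have [->|ik] := eqVneq i k.
  by rewrite swap_variationxx !mulr_ge0 ?addr_ge0 ?mulr_ge0 ?invr_ge0// ltW.
have tE : tperm i k = (tperm j k * tperm i j * tperm j k)%g.
  have := tpermJ i j (tperm j k); rewrite tpermL tpermD 1?eq_sym// => <-.
  by rewrite /conjg tpermV mulgA.
set t := tperm j k in tE *; set r := tperm i j in tE *.
pose a s := f (r * (t * s))%g - f (t * s)%g.
pose b s := f (t * (r * (t * s)))%g - f (r * (t * s))%g.
pose c s := f (t * s)%g - f s.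
have aE : \sum_s a s ^+ 2 = swap_variation f i j.
  by rewrite /swap_variation [RHS](reindex_inj (mulgI t)).
have bE : \sum_s b s ^+ 2 = swap_variation f j k.
  rewrite /swap_variation [RHS](reindex_inj (mulgI (r * t)%g)).
  by apply: eq_bigr => s _; rewrite /b !mulgA.
have -> : 2 * swap_variation f j k = \sum_s b s ^+ 2 + \sum_s c s ^+ 2.
  by rewrite bE mulr_natl mulr2n.
rewrite -aE [X in _ * X]addrA mulr_suml -!big_split/= mulr_sumr.
apply: ler_sum => s _. apply: le_trans (sqr_add3_le _ _ _ K0).
rewrite /a /b /c tE -!mulgA le_eqVlt; apply/orP; left; apply/eqP; ring.
Qed.

Section Torus.
Variables (R : realType) (m d : nat).
Local Notation V := (torus_vertex m d).
Variables (lab : 'I_(m.+1 ^ d) -> V) (pos : V -> 'I_(m.+1 ^ d)).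
Hypotheses (labK : cancel lab pos) (posK : cancel pos lab).
Local Notation N := (m.+1 ^ d)%N.
Local Notation adj := (labelled_torus_adj lab).
Implicit Types (f : 'S_N -> R) (v w x y : V).

Lemma torus_adj_sym : symmetric adj.
Proof.
move=> i j; rewrite /labelled_torus_adj /= /torus_adj eq_sym; congr (_ && _).
by apply: eq_existsb => k; rewrite -opprB eqr_opp orbC eqr_oppLR.
Qed.

Lemma torus_adj_irr : irreflexive adj.
Proof. by move=> i; rewrite /labelled_torus_adj /= /torus_adj eqxx. Qed.

Lemma edge_variation_torus f :
  edge_variation adj f
  = \sum_x \sum_(y | torus_adj x y) swap_variation f (pos x) (pos y).
Proof.
rewrite pair_big_dep/= /edge_variation.
rewrite (reindex (fun p : V * V => (pos p.1, pos p.2)))/=; last first.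
  exists (fun p => (lab p.1, lab p.2)) => -[i j] _ /=; first by rewrite !posK.
  by rewrite !labK.
by apply: eq_bigl => -[x y]; rewrite /labelled_torus_adj/= !posK.
Qed.

Definition shift_variation f v : R := \sum_x swap_variation f (pos x) (pos (x + v)).

Lemma shift_variationD f v w (K : R) : 0 < K ->
  shift_variation f (v + w)
  <= (K + 2) * (shift_variation f v / K + 2 * shift_variation f w).
Proof.
move=> K0; rewrite /shift_variation [X in 2 * X](reindex_inj (addIr v))/=.
rewrite mulr_suml mulr_sumr -big_split mulr_sumr; apply: ler_sum => x _ /=.
by rewrite addrA; exact: swap_variation_triangle.
Qed.

Lemma sum_unit_vector v : v = \sum_j unit_vector m j *+ v j.
Proof.
apply/ffunP => i; rewrite sum_ffunE (bigD1 i)//= big1 ?addr0 => [|j ji].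
  rewrite ffunMnE ffunE eqxx Zp_mulrn; apply: val_inj.
  by rewrite /= modnMml mul1n modn_small.
by rewrite ffunMnE ffunE eq_sym (negPf ji) mul0rn.
Qed.

(** The bound (2k+1)^2 M after k unit steps is reproduced by
    [shift_variationD] with K = 2k+1: (K+2)((K^2 M)/K + 2M) = (K+2)^2 M. *)
Lemma shift_variation_le f M v : 0 <= M ->
  (forall j, shift_variation f (unit_vector m j) <= M) ->
  shift_variation f v <= (2 * (d * m)%:R + 1) ^+ 2 * M.
Proof.
move=> M0 eM; pose P k w := shift_variation f w <= (2 * k%:R + 1) ^+ 2 * M.
have P0 : P 0%N 0.
  rewrite /P /shift_variation big1 ?mulr_ge0 ?sqr_ge0// => x _.
  by rewrite addr0 swap_variationxx.
have Pe k w j : P k w -> P k.+1 (w + unit_vector m j).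
  rewrite /P => Pw; have K0 : 0 < 2 * k%:R + 1 :> R by rewrite ltr_wpDl// mulr_ge0.
  apply: (le_trans (shift_variationD f w (unit_vector m j) K0)).
  have -> : (2 * k.+1%:R + 1) ^+ 2 * M
      = (2 * k%:R + 1 + 2) * ((2 * k%:R + 1) * M + 2 * M) by rewrite -natr1; ring.
  rewrite ler_pM2l; last by rewrite addr_gt0.
  rewrite lerD//; last by rewrite ler_pM2l.
  by rewrite ler_pdivrMr// mulrAC -expr2.
have Pen k w j c : P k w -> P (k + c)%N (w + unit_vector m j *+ c).
  move=> Pw; elim: c => [|c IH]; first by rewrite addn0 mulr0n addr0.
  by rewrite addnS mulrSr addrA; exact: Pe.
have Psum (r : seq 'I_d) :
    P (\sum_(j <- r) v j)%N (\sum_(j <- r) unit_vector m j *+ v j).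
  elim: r => [|j r IH]; first by rewrite !big_nil.
  by rewrite !big_cons addnC addrC; exact: Pen.
have := Psum (index_enum 'I_d); rewrite -sum_unit_vector => /le_trans; apply.
apply: ler_wpM2r => //; rewrite ler_sqr ?nnegrE ?addr_ge0 ?mulr_ge0//.
rewrite lerD2r ler_pM2l// ler_nat.
apply: (@leq_trans (\sum_(j < d) m)); last by rewrite sum_nat_const card_ord.
by apply: leq_sum => j _; rewrite -ltnS.
Qed.

(** The hypothesis that m is positive makes the unit vectors nonzero. *)
Lemma shift_variation_le_edge f j : (0 < m)%N ->
  shift_variation f (unit_vector m j) <= edge_variation adj f.
Proof.
move=> m0; rewrite edge_variation_torus; apply: ler_sum => x _.
have e0 : unit_vector m j != 0.
  apply: contraTneq isT => /ffunP/(_ j); rewrite !ffunE eqxx => /(congr1 val)/=.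
  by rewrite modn_small.
rewrite (bigD1 (x + unit_vector m j))/=; last first.
  rewrite /torus_adj -subr_eq0 opprD addNKr oppr_eq0 e0/=.
  by apply/existsP; exists j; rewrite eqxx orbT.
by rewrite lerDl sumr_ge0// => y _; exact: swap_variation_ge0.
Qed.

(** Any v is reached in at most d m unit steps, and there are N choices of v. *)
Lemma torus_comparison f : (0 < d)%N ->
  \sum_i \sum_j swap_variation f i j
  <= 9 * d%:R ^+ 2 * m.+1%:R ^+ 2 * N%:R * edge_variation adj f.
Proof.
move=> d0; have E0 := edge_variation_ge0 adj f.
have -> : \sum_i \sum_j swap_variation f i j = \sum_v shift_variation f v.
  rewrite [RHS]exchange_big/= (reindex pos)/=; last by exists lab => x _.
  apply: eq_bigr => x _; rewrite (reindex pos)/=; last by exists lab => y _.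
  by rewrite (reindex_inj (addrI x)).
have [m0|m0] := posnP m.
  rewrite big1 ?mulr_ge0 ?exprn_ge0// => v _; apply: big1 => x _.
  rewrite (_ : v = 0) ?addr0 ?swap_variationxx//.
  apply/ffunP => i; rewrite ffunE; apply: val_inj => /=.
  by case: (v i) => k /=; rewrite m0 ltnS leqn0 => /eqP.
apply: (@le_trans _ _
  (\sum_(v : V) (2 * (d * m)%:R + 1) ^+ 2 * edge_variation adj f)).
  apply: ler_sum => v _; apply: shift_variation_le => // j.
  exact: shift_variation_le_edge.
rewrite sumr_const card_ffun !card_ord -[leLHS]mulr_natr.
rewrite [leRHS]mulrAC. apply: ler_wpM2r => //; apply: ler_wpM2r => //.
have -> : 9 * d%:R ^+ 2 * m.+1%:R ^+ 2 = (3 * (d * m.+1)%:R) ^+ 2 :> R.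
  by rewrite natrM; ring.
rewrite ler_sqr ?nnegrE ?addr_ge0 ?mulr_ge0//.
rewrite -!(natrM, natrD, natr1) -(natrD _ _ 1) ler_nat.
by rewrite mulnS mulnDr addnC leq_add ?muln_gt0// leq_mul2r orbT.
Qed.

End Torus.

(** * A slow function on the torus *)

Lemma sin_le_id (R : realType) (x : R) : 0 <= x -> sin x <= x.
Proof.
move=> x0; have sinC : {within `[0, x], continuous (@sin R)}.
  by apply: continuous_subspaceT; exact: continuous_sin.
have [c _] := MVT_segment x0 (fun y _ => is_derive_sin y) sinC.
by rewrite sin0 !subr0 => ->; rewrite ler_piMl// cos_le1.
Qed.

Lemma pi_le4 (R : realType) : pi <= 4 :> R.
Proof. by have [/andP[_ h] _] := @pihalf_02_cos_pihalf R; lra. Qed.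

Section TestFunction.
Variables (R : realType) (m d : nat).
Local Notation V := (torus_vertex m d).
Variables (lab : 'I_(m.+1 ^ d) -> V) (pos : V -> 'I_(m.+1 ^ d)).
Hypotheses (labK : cancel lab pos) (posK : cancel pos lab).
Local Notation N := (m.+1 ^ d)%N.
Local Notation adj := (labelled_torus_adj lab).
Implicit Types (phi : V -> R) (v w x y : V) (s : 'S_N).

(** The interchange process moves s to s composed with a transposition of the
    arguments, so it is the inverse image of a fixed label that moves along
    the edges of the graph, as a random walk. *)
Definition particle s : V := lab (s^-1%g (pos 0)).

(** The position of the particle is uniform under the uniform law on S_N. *)
Lemma sum_particle_shift phi v :
  \sum_s phi (particle s + v) = \sum_s phi (particle s).
Proof.
have rho_inj : injective (fun i => pos (lab i + v)).
  by move=> i j /(can_inj posK) /addIr /(can_inj labK).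
rewrite [RHS](reindex_inj (mulgI (perm rho_inj)^-1%g))/=.
apply: eq_bigr => s _; congr phi.
by rewrite /particle invMg invgK permM [perm rho_inj _]permE posK.
Qed.

Lemma swap_variation_particle phi x y :
  swap_variation (phi \o particle) (pos x) (pos y)
  <= \sum_s ((particle s == x)%:R + (particle s == y)%:R) * (phi x - phi y) ^+ 2.
Proof.
have [->|xy] := eqVneq x y.
  by rewrite swap_variationxx; apply: sumr_ge0 => s _; rewrite mulr_ge0 ?sqr_ge0.
apply: ler_sum => s _; rewrite /= /particle invMg tpermV permM.
have pos_eq (z : V) (i : 'I_N) : (lab i == z) = (i == pos z).
  by rewrite -(inj_eq (can_inj posK)) labK.
rewrite !pos_eq; case: tpermP => [->|->|ix iy].
- by rewrite !posK eqxx (inj_eq (can_inj posK)) (negPf xy) addr0 mul1r -opprB sqrrN.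
- by rewrite !posK eqxx eq_sym (inj_eq (can_inj posK)) (negPf xy) add0r mul1r.
- by rewrite subrr expr0n mulr_ge0 ?sqr_ge0.
Qed.

(** An inequality suffices and avoids any discussion of coinciding neighbours:
    on a torus of side 2, x + e and x - e are the same vertex. *)
Lemma edge_variation_particle phi :
  edge_variation adj (phi \o particle)
  <= \sum_j 2 * \sum_s
       ((phi (particle s) - phi (particle s + unit_vector m j)) ^+ 2 +
        (phi (particle s) - phi (particle s - unit_vector m j)) ^+ 2).
Proof.
set f := phi \o particle; rewrite (edge_variation_torus labK posK).
pose sv x y := swap_variation f (pos x) (pos y).
have sv0 x y : 0 <= sv x y by exact: swap_variation_ge0.
have nbr x : \sum_(y | torus_adj x y) sv x y
    <= \sum_j (sv x (x + unit_vector m j) + sv x (x - unit_vector m j)).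
  apply: (@le_trans _ _ (\sum_y \sum_j
    ((y == x + unit_vector m j)%:R + (y == x - unit_vector m j)%:R) * sv x y)).
    rewrite big_mkcond; apply: ler_sum => y _; case: ifPn => [|_]; last first.
      by apply: sumr_ge0 => j _; rewrite mulr_ge0.
    case/andP => _ /existsP[j xyj]; rewrite (bigD1 j)//= -[leLHS]addr0.
    apply: lerD; last by apply: sumr_ge0 => k _; rewrite mulr_ge0.
    rewrite ler_peMl//; case/orP: xyj => /eqP xyj.
      by rewrite [X in _ + X](_ : _ = 1) ?lerDr// -xyj opprB addrC subrK eqxx.
    rewrite [X in X + _](_ : _ = 1) ?lerDl//.
    by rewrite -[unit_vector m j]opprK -xyj opprB addrC subrK eqxx.
  rewrite exchange_big; apply: ler_sum => j _ /=.
  under eq_bigr do rewrite mulrDl.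
  rewrite big_split/=; apply: lerD.
    rewrite (bigD1 (x + unit_vector m j))//= eqxx mul1r big1 ?addr0//.
    by move=> y /negPf->; rewrite mul0r.
  rewrite (bigD1 (x - unit_vector m j))//= eqxx mul1r big1 ?addr0//.
    by move=> y /negPf->; rewrite mul0r.
apply: (le_trans (ler_sum _ (fun x _ => nbr x))).
rewrite exchange_big; apply: ler_sum => j _ /=; set e := unit_vector m j.
have -> : \sum_x (sv x (x + e) + sv x (x - e)) = 2 * \sum_x sv x (x + e).
  rewrite big_split mulr_natl mulr2n/=; congr (_ + _).
  rewrite (reindex_inj (addIr e))/=; apply: eq_bigr => x _.
  by rewrite addrK /sv swap_variationC.
rewrite ler_pM2l//.
apply: (le_trans (ler_sum _ (fun x _ => swap_variation_particle phi x (x + e)))).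
rewrite exchange_big; apply: ler_sum => s _ /=.
under eq_bigr do rewrite mulrDl.
rewrite big_split/=; apply: lerD.
  rewrite (bigD1 (particle s))//= eqxx mul1r big1 ?addr0// => x xs.
  by rewrite eq_sym (negPf xs) mul0r.
rewrite (bigD1 (particle s - e))//= subrK eqxx mul1r big1 ?addr0 => [|x xs].
  by rewrite -opprB sqrrN.
by rewrite -[_ == x + e]subr_eq eq_sym (negPf xs) mul0r.
Qed.

Hypotheses (d_gt0 : (0 < d)%N) (m_gt0 : (0 < m)%N).
Let j0 : 'I_d := Ordinal d_gt0.
Let e0 : V := unit_vector m j0.
Let ang : R := 2 * pi / m.+1%:R.

Definition wave x : R := cos (ang * (x j0)%:R).

(** Coordinates are integers modulo the side m+1, so adding the unit vector
    increases the angle by [ang] up to a multiple of 2 pi. *)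
Lemma ang_shift x : exists q : nat,
  ang * ((x + e0)%R j0)%:R + pi *+ 2 *+ q = ang * (x j0)%:R + ang.
Proof.
exists ((x j0 + 1) %/ m.+1)%N.
have -> : ((x + e0)%R j0 : nat) = ((x j0 + 1) %% m.+1)%N.
  by rewrite /e0 !ffunE eqxx /= modnDmr.
have -> : pi *+ 2 *+ ((x j0 + 1) %/ m.+1)
    = ang * ((x j0 + 1) %/ m.+1 * m.+1)%N%:R :> R.
  rewrite /ang natrM -[LHS]mulr_natr -[pi *+ 2]mulr_natr.
  by field; rewrite ?nat1r ?natr1 pnatr_eq0.
by rewrite -mulrDr -natrD addnC -divn_eq natrD mulrDr mulr1.
Qed.

Lemma wave_laplacian x : wave (x + e0) + wave (x - e0) = 2 * cos ang * wave x.
Proof.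
have shift y : wave (y + e0) = cos (ang * (y j0)%:R + ang).
  by have [q <-] := ang_shift y; rewrite (periodicn (@cosD2pi R)).
have back : wave (x - e0) = cos (ang * (x j0)%:R - ang).
  have [q] := ang_shift (x - e0); rewrite subrK => h.
  rewrite /wave -[ang * ((x - e0)%R j0)%:R](addrK ang) -h addrAC.
  by rewrite (periodicn (@cosD2pi R)).
by rewrite shift back cosD cosB /wave; ring.
Qed.

Lemma half_angle : cos ang = 1 - 2 * sin (pi / m.+1%:R) ^+ 2.
Proof.
have -> : ang = (pi / m.+1%:R) *+ 2 by rewrite /ang -mulrA mulr_natl.
by rewrite cos_mulr2n cos2sin2 -mulr_natl; ring.
Qed.

(** Summing [wave_laplacian] over a shift-invariant law multiplies the mean of
    [wave] by cos ang, which is not 1. *)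
Lemma sum_wave : \sum_s wave (particle s) = 0.
Proof.
have c1 : 1 - cos ang != 0.
  rewrite half_angle opprB addrC subrK mulf_neq0// expf_neq0// gt_eqF//.
  apply: sin_gt0_pi; rewrite divr_gt0 ?pi_gt0//= ltr_pdivrMr//.
  by rewrite ltr_pMr ?pi_gt0// ltr1n ltnS.
apply: (mulfI c1); rewrite mulr0.
have : \sum_s (wave (particle s + e0) + wave (particle s - e0))
    = \sum_s 2 * cos ang * wave (particle s).
  by apply: eq_bigr => s _; exact: wave_laplacian.
by rewrite big_split/= !sum_particle_shift -mulr_sumr; lra.
Qed.

Lemma edge_variation_wave :
  edge_variation adj (wave \o particle)
  <= 256 / m.+1%:R ^+ 2 * inner (wave \o particle) (wave \o particle).
Proof.
apply: (le_trans (edge_variation_particle wave)).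
rewrite (bigD1 j0)//= [X in _ + X]big1 ?addr0 => [|j jj0]; last first.
  rewrite big1 ?mulr0// => s _.
  have wE (v : V) : wave (particle s + v)
      = cos (ang * ((particle s j0 + v j0)%R : 'I_m.+1)%:R).
    by rewrite /wave ffunE.
  rewrite !wE !ffunE eq_sym (negPf jj0) oppr0 addr0 /wave subrr expr0n/=.
  exact: addr0.
set S := inner _ _; pose s1 : R := sin (pi / m.+1%:R).
have SE : S = \sum_s wave (particle s) ^+ 2 by [].
have -> : \sum_s ((wave (particle s) - wave (particle s + e0)) ^+ 2 +
    (wave (particle s) - wave (particle s - e0)) ^+ 2) = 8 * s1 ^+ 2 * S.
  transitivity (\sum_s (wave (particle s + e0) ^+ 2 + wave (particle s - e0) ^+ 2
      + (2 - 4 * cos ang) * wave (particle s) ^+ 2)).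
    apply: eq_bigr => s _; have := wave_laplacian (particle s).
    move: (wave _) (wave _) (wave _) => a b c h.
    rewrite [RHS](_ : _ = b ^+ 2 + c ^+ 2 + 2 * a ^+ 2
      - 2 * a * (2 * cos ang * a)); last by ring.
    by rewrite -h; ring.
  rewrite !big_split/= -mulr_sumr !(sum_particle_shift (fun x => wave x ^+ 2)).
  by rewrite -SE half_angle -/s1; ring.
rewrite mulrA; apply: ler_wpM2r; first exact: inner_ge0.
have p0 : 0 <= pi / m.+1%:R :> R by rewrite divr_ge0// pi_ge0.
have s1le : s1 <= pi / m.+1%:R by exact: sin_le_id.
have s10 : 0 <= s1.
  by apply: sin_ge0_pi; rewrite p0 ler_pdivrMr// ler_pMr ?pi_gt0// ler1n.
apply: (@le_trans _ _ (16 * (pi / m.+1%:R) ^+ 2)).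
  by rewrite mulrA -natrM ler_pM2l// ler_sqr.
rewrite expr_div_n mulrA ler_pM2r ?invr_gt0 ?exprn_gt0//.
have := pi_le4 R; have := @pi_ge0 R; nra.
Qed.

Lemma wave_neq0 : 0 < inner (wave \o particle) (wave \o particle).
Proof.
rewrite lt_def inner_ge0 andbT; apply/eqP => /inner_eq0/(congr1 (@^~ 1%g))/=.
rewrite /wave /particle invg1 perm1 posK ffunE mulr0 cos0.
by move=> /eqP; rewrite oner_eq0.
Qed.

End TestFunction.

(** * Relaxation times *)

Section Relaxation.
Variables (R : realType) (T : finType).
Implicit Types (Q : (T -> R) -> T -> R) (f g : T -> R).

Local Notation positive_spectrum Q :=
  [set theta | 0 < theta /\ is_eigenvalue_opp Q theta].

Lemma relaxation_time_ge0 Q : 0 <= relaxation_time Q.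
Proof.
rewrite invr_ge0; have [->|/set0P S0] := eqVneq (positive_spectrum Q) set0.
  by rewrite inf0.
by apply: lb_le_inf => // theta [/ltW].
Qed.

Lemma relaxation_time_le Q c : 0 < c ->
  (forall theta, 0 < theta -> is_eigenvalue_opp Q theta -> c <= theta) ->
  relaxation_time Q <= c^-1.
Proof.
move=> c0 cP; rewrite /relaxation_time.
have [->|/set0P S0] := eqVneq (positive_spectrum Q) set0.
  by rewrite inf0 invr0 invr_ge0 ltW.
have cinf : c <= inf (positive_spectrum Q).
  by apply: lb_le_inf => // theta [theta0 Qtheta]; exact: cP.
by rewrite lef_pV2// posrE// (lt_le_trans c0).
Qed.

Lemma relaxation_time_ge Q c theta : 0 < c ->
  (forall theta, 0 < theta -> is_eigenvalue_opp Q theta -> c <= theta) ->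
  0 < theta -> is_eigenvalue_opp Q theta -> theta^-1 <= relaxation_time Q.
Proof.
move=> c0 cP theta0 Qtheta; rewrite /relaxation_time.
set S := [set _ | _]; have lbS : lbound S c by move=> t [t0 Qt]; exact: cP.
have Stheta : S theta by [].
have cinf : c <= inf S by apply: lb_le_inf => //; exists theta.
rewrite lef_pV2; [|by rewrite posrE|by rewrite posrE (lt_le_trans c0)].
by apply: ge_inf => //; exists c.
Qed.

(** The variational principle for the spectral gap.  The Poincare inequality
    [gap] excludes eigencomponents of f with eigenvalue at most zero, so some
    component has a positive eigenvalue that is at most the Rayleigh quotient
    of f. *)
Lemma exists_eigenvalue_le Q c rho f : linear Q -> self_adjoint Q ->
  Q (fun=> 1) = 0 -> 0 < c ->
  (forall g, inner g (fun=> 1) = 0 -> c * inner g g <= energy Q g) ->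
  inner f (fun=> 1) = 0 -> 0 < inner f f -> energy Q f <= rho * inner f f ->
  exists theta, [/\ 0 < theta, theta <= rho & is_eigenvalue_opp Q theta].
Proof.
move=> Qlin Qsym Q1 c0 gap f1 f0 frho.
have [s us dec] := spectral_decomposition Qlin Qsym; have [u fE Qu] := dec f.
have Q1' : Q (fun=> 1) = (- 0) *: (fun=> 1) by rewrite Q1 oppr0 scale0r.
have mean0 l : l \in s -> inner (u l) (fun=> 1) = 0.
  have [->|l0 _] := eqVneq l 0; last exact: (eigen_orthogonal Qsym (Qu l) Q1').
  move=> s0; move: f1; rewrite fE inner_suml (bigD1_seq 0)//= big1 ?addr0//.
  by move=> k k0; exact: (eigen_orthogonal Qsym (Qu k) Q1').
have f1E : f = \sum_(l <- s) 1 *: u l.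
  by rewrite {1}fE; apply: eq_bigr => l _; rewrite scale1r.
have ffE : inner f f = \sum_(l <- s) inner (u l) (u l).
  rewrite f1E (inner_expansion Qsym)//.
  by apply: eq_bigr => l _; rewrite !mul1r.
have efE : energy Q f = \sum_(l <- s) l * inner (u l) (u l).
  rewrite /energy; have -> : Q f = \sum_(l <- s) (- l) *: u l.
    have := iter_expansion Qlin s 1 Qu; rewrite -fE /= => ->.
    by apply: eq_bigr => l _; rewrite expr1.
  rewrite {1}f1E (inner_expansion Qsym)// -sumrN.
  by apply: eq_bigr => l _; rewrite mul1r mulNr opprK.
have [/hasP[l ls /andP[ul lrho]]|/hasPn none] :=
    boolP (has (fun l => (0 < inner (u l) (u l)) && (l <= rho)) s).
  exists l; split=> //.
    have := gap _ (mean0 l ls); rewrite /energy Qu innerZr mulNr opprK.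
    by rewrite ler_pM2r//; exact: lt_le_trans.
  exists (u l); split=> [|x].
    apply: contrapT => /forallNP ul0; move: ul; rewrite /inner big1 ?ltxx// => x _.
    by have /negP := ul0 x; rewrite negbK => /eqP ->; rewrite mul0r.
  by rewrite Qu /= -[((- l) *: u l) x]/(- l * u l x) mulNr opprK.
exfalso; move: frho; rewrite leNgt => /negP; apply.
rewrite efE ffE mulr_sumr.
have [l ls ul] : exists2 l, l \in s & 0 < inner (u l) (u l).
  apply: contrapT => no; move: f0; rewrite ffE big_seq big1 ?ltxx// => l ls.
  apply/eqP; rewrite eq_le inner_ge0 andbT leNgt.
  by apply/negP => ul; apply: no; exists l.
rewrite !(bigD1_seq l)//=; apply: ltr_leD.
  by rewrite ltr_pM2r// ltNge; move: (none l ls); rewrite ul.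
rewrite big_seq_cond [leRHS]big_seq_cond; apply: ler_sum => k /andP[ks _].
have [->|uk] := eqVneq (inner (u k) (u k)) 0; first by rewrite !mulr0.
have uk0 : 0 < inner (u k) (u k) by rewrite lt_def uk inner_ge0.
by rewrite ler_pM2r// ltW// ltNge; move: (none k ks); rewrite uk0.
Qed.

End Relaxation.

Section Comparison.
Variables (R : realType) (m d : nat).
Local Notation V := (torus_vertex m d).
Variables (lab : 'I_(m.+1 ^ d) -> V) (pos : V -> 'I_(m.+1 ^ d)).
Hypotheses (labK : cancel lab pos) (posK : cancel pos lab).
Hypothesis (d_gt0 : (0 < d)%N).
Local Notation N := (m.+1 ^ d)%N.
Local Notation adjT := (labelled_torus_adj lab).
Local Notation adjK := (@complete_adj N).
Variables (nuK nuT : R).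
Hypotheses (nuK_gt0 : 0 < nuK) (nuT_gt0 : 0 < nuT).
Local Notation QK := (interchange_generator adjK nuK).
Local Notation QT := (interchange_generator adjT nuT).

Lemma complete_adj_sym : symmetric adjK.
Proof. by move=> i j; rewrite /complete_adj eq_sym. Qed.

Lemma complete_adj_irr : irreflexive adjK.
Proof. by move=> i; rewrite /complete_adj eqxx. Qed.

Lemma edge_variation_complete (f : 'S_N -> R) :
  edge_variation adjK f = \sum_i \sum_j swap_variation f i j.
Proof.
rewrite pair_bigA /edge_variation [RHS](bigID (fun p => adjK p.1 p.2))/=.
rewrite [X in _ = _ + X]big1 ?addr0// => -[i j] /=.
by rewrite /complete_adj negbK => /eqP ->; exact: swap_variationxx.
Qed.

Let N_gt0 : 0 < N%:R :> R.
Proof. by rewrite ltr0n expn_gt0. Qed.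

Lemma relaxation_complete : relaxation_time QK <= 4 / (nuK * N%:R).
Proof.
have c0 : 0 < nuK * N%:R / 4 by rewrite divr_gt0// mulr_gt0.
rewrite -invf_div; apply: (relaxation_time_le c0) => theta.
apply: eigenvalue_ge complete_adj_sym complete_adj_irr _ => g g0.
rewrite (mulrAC nuK) -[leLHS]mulrA edge_variation_complete ler_pM2l ?divr_gt0//.
exact: transposition_poincare.
Qed.

Let cT : R := nuT / (36 * d%:R ^+ 2 * m.+1%:R ^+ 2).

Let cT_gt0 : 0 < cT.
Proof. by rewrite divr_gt0// !mulr_gt0 ?exprn_gt0 ?ltr0n. Qed.

Lemma torus_poincare (f : 'S_N -> R) : \sum_s f s = 0 ->
  cT * inner f f <= nuT / 4 * edge_variation adjT f.
Proof.
move=> f0; have d0 : d%:R != 0 :> R by rewrite pnatr_eq0 -lt0n.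
have n0 : m.+1%:R != 0 :> R by rewrite pnatr_eq0.
have := le_trans (transposition_poincare f0) (torus_comparison labK posK f d_gt0).
rewrite [leRHS]mulrAC [leRHS]mulrC ler_pM2l// => h.
rewrite /cT; have -> : nuT / (36 * d%:R ^+ 2 * m.+1%:R ^+ 2)
   = nuT / 4 / (9 * d%:R ^+ 2 * m.+1%:R ^+ 2) :> R.
  by move: (m.+1%:R) n0 => n n0; field; rewrite d0 n0.
rewrite -[leLHS]mulrA ler_pM2l ?divr_gt0// ler_pdivrMl//.
by rewrite !mulr_gt0 ?exprn_gt0 ?ltr0n.
Qed.

(** Rayleigh quotient of [wave]; [torus_poincare] keeps the infimum in the
    definition of the relaxation time away from 0. *)
Lemma relaxation_torus : (0 < m)%N ->
  m.+1%:R ^+ 2 / (64 * nuT) <= relaxation_time QT.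
Proof.
move=> m0; have gap theta : 0 < theta -> is_eigenvalue_opp QT theta -> cT <= theta.
  apply: eigenvalue_ge _ _ torus_poincare.
    exact: torus_adj_sym.
  exact: torus_adj_irr.
have [||||theta [theta0 theta_le eig]] := @exists_eigenvalue_le _ _ QT cT
    (64 * nuT / m.+1%:R ^+ 2) (@wave R m d d_gt0 \o particle lab pos)
    (@interchange_linear _ _ _ _) (@interchange_sym _ _ _ _)
    (@interchange_const _ _ _ _) cT_gt0.
- move=> g g0; rewrite energy_interchange//; 
    [|exact: torus_adj_sym|exact: torus_adj_irr].
  apply: torus_poincare; move: g0; rewrite /inner.
  by under eq_bigr do rewrite mulr1.
- rewrite -[RHS](sum_wave R labK posK d_gt0 m0).
  by apply: eq_bigr => s _; rewrite mulr1.
- exact: wave_neq0.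
- rewrite energy_interchange//; [|exact: torus_adj_sym|exact: torus_adj_irr].
  have := edge_variation_wave R labK posK d_gt0.
  rewrite -(ler_pM2l (x := nuT / 4)) ?divr_gt0// => /le_trans; apply.
  rewrite mulrA le_eqVlt; apply/orP; left; apply/eqP; congr (_ * _).
  have n0 : m.+1%:R != 0 :> R by rewrite pnatr_eq0.
  by move: (m.+1%:R) n0 => n n0; field.
apply: le_trans (relaxation_time_ge cT_gt0 gap theta0 eig).
by rewrite -invf_div lef_pV2// posrE divr_gt0 ?mulr_gt0 ?exprn_gt0.
Qed.

(** The powers of n and the rates cancel between [relaxation_complete],
    [torus_comparison] and [relaxation_torus]; 48^2 = 4 * 9 * 64. *)
Lemma energy_comparison (f : 'S_N -> R) :
  relaxation_time QK * energy QK f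
  <= (48 * d%:R) ^+ 2 * (relaxation_time QT * energy QT f).
Proof.
rewrite (energy_interchange _ _ complete_adj_sym complete_adj_irr).
rewrite (energy_interchange _ _ (torus_adj_sym lab) (torus_adj_irr lab)).
rewrite edge_variation_complete; set S := \sum_i _.
have S0 : 0 <= S.
  by apply: sumr_ge0 => i _; apply: sumr_ge0 => j _; exact: swap_variation_ge0.
have E0 := edge_variation_ge0 adjT f.
have [m0|m0] := posnP m.
  (* On a single vertex there is nothing to swap. *)
  have -> : S = 0.
    apply: big1 => i _; apply: big1 => j _; rewrite (_ : i = j) ?swap_variationxx//.
    have I1 (k : 'I_N) : k = 0%N :> nat.
      by case: k => k /=; rewrite m0 exp1n ltnS leqn0 => /eqP.
    by apply: val_inj; rewrite /= !I1.
  rewrite [leLHS](_ : _ = 0); last by rewrite mulr0 mulr0.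
  rewrite mulr_ge0 ?sqr_ge0// mulr_ge0 ?relaxation_time_ge0//.
  by rewrite mulr_ge0// divr_ge0// ltW.
have n0 : m.+1%:R != 0 :> R by rewrite pnatr_eq0.
apply: (@le_trans _ _ (4 / (nuK * N%:R) * (nuK / 4 * S))).
  apply: ler_wpM2r relaxation_complete.
  by rewrite mulr_ge0// divr_ge0// ltW.
apply: (@le_trans _ _ ((48 * d%:R) ^+ 2 *
  (m.+1%:R ^+ 2 / (64 * nuT) * (nuT / 4 * edge_variation adjT f)))).
  rewrite (_ : _ * (_ * S) = N%:R^-1 * S); last first.
    by move: (N%:R) N_gt0 => n n1; field; rewrite !gt_eqF.
  rewrite ler_pdivrMl//; apply: (le_trans (torus_comparison labK posK f d_gt0)).
  rewrite le_eqVlt; apply/orP; left; apply/eqP.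
  by move: (N%:R) (m.+1%:R) => n k; field; rewrite gt_eqF.
apply: ler_wpM2l; first exact: sqr_ge0.
apply: ler_wpM2r (relaxation_torus m0).
by rewrite mulr_ge0// divr_ge0// ltW.
Qed.

End Comparison.

(** * Transfer of sensitivity and stability between comparable chains *)

Section Transfer.
Variables (R : realType) (T : finType) (QA QB : (T -> R) -> T -> R).
Hypotheses (Alin : linear QA) (Asym : self_adjoint QA)
  (Aneg : forall f, 0 <= energy QA f).
Hypotheses (Blin : linear QB) (Bsym : self_adjoint QB)
  (Bneg : forall f, 0 <= energy QB f).
Variables (tA tB C : R).
Hypotheses (tA0 : 0 <= tA) (tB0 : 0 <= tB) (C0 : 0 <= C).
Hypothesis AB : forall f, tA * energy QA f <= C * (tB * energy QB f).
Implicit Types (f g : T -> R) (alpha beta eta : R).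

(** A function smoothed by the semigroup of B has bounded energy for B, hence
    for A. *)
Lemma energy_smoothed alpha beta f : 0 <= alpha -> 0 < beta ->
  alpha * tA * energy QA (semigroup QB (beta * tB) f)
  <= alpha * C / beta * inner f f.
Proof.
move=> a0 b0; rewrite -mulrA -!(mulrA alpha) ler_wpM2l//.
apply: (le_trans (AB _)); rewrite -mulrA ler_wpM2l// ler_pdivlMl// mulrA.
by apply: energy_semigroup_le => //; rewrite mulr_ge0// ltW.
Qed.

Lemma inner_young eta f g : 0 < eta ->
  inner f g <= (inner f f / eta + eta * inner g g) / 2.
Proof.
move=> e0; have := inner_ge0 (f - eta *: g).
rewrite !(innerDl, innerDr, innerNl, innerNr, innerZl, innerZr) [inner g f]innerC.
move: (inner f f) (inner f g) (inner g g) => a b c h.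
rewrite ler_pdivlMr// -(ler_pM2r e0) mulrDl divfK ?gt_eqF//; lra.
Qed.

(** With v = P_B f and P = P_A, split <f, v> = <P f, v> + <f, v - P v>; by
    [energy_smoothed], v - P v is of order beta in squared norm. *)
Lemma sensitivity_transfer alpha beta eta f :
  0 < alpha -> 0 <= beta -> 0 < eta ->
  inner f (semigroup QB (alpha * tB) f)
  <= inner f (semigroup QA (2 * (beta * tA)) f) / (2 * eta)
     + (eta + beta * C / (2 * eta * alpha)) * inner f f.
Proof.
move=> a0 b0 e0; set v := semigroup QB (alpha * tB) f.
have bt0 : 0 <= beta * tA by rewrite mulr_ge0.
pose P := semigroup QA (beta * tA).
have -> : inner f v = inner (P f) v + inner f (v - P v).
  by rewrite innerDr innerNr (semigroup_sym Alin Asym) addrC subrK.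
have vv : inner v v <= inner f f.
  by apply: semigroup_contraction => //; rewrite mulr_ge0// ltW.
have vPv : inner (v - P v) (v - P v) <= beta * C / alpha * inner f f.
  apply: (le_trans (sub_semigroup_le_energy Alin Asym Aneg v bt0)).
  exact: energy_smoothed.
have y1 := inner_young (P f) v e0; have := inner_young (v - P v) f e0.
rewrite [inner _ f]innerC => y2.
apply: (le_trans (lerD y1 y2)).
rewrite (inner_semigroup_double Alin Asym Aneg) -/P.
move: (inner (P f) (P f)) vv vPv => p vv vPv.
have h1 : eta * inner v v <= eta * inner f f by rewrite ler_pM2l.
have h2 : inner (v - P v) (v - P v) / eta <= beta * C / alpha * inner f f / eta.
  by rewrite ler_pM2r ?invr_gt0.
have -> : p / (2 * eta) + (eta + beta * C / (2 * eta * alpha)) * inner f f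
   = (p / eta + eta * inner f f) / 2
     + (beta * C / alpha * inner f f / eta + eta * inner f f) / 2.
  by field; rewrite !gt_eqF.
lra.
Qed.

(** Split f into the smoothed part g = P_B f, whose energy is controlled, and the
    rest f - g, whose norm is controlled by the stability for B. *)
Lemma stability_transfer alpha beta f : 0 <= alpha -> 0 < beta ->
  inner f (f - semigroup QA (alpha * tA) f)
  <= 2 * (alpha * C / beta) * inner f f
     + 2 * inner f (f - semigroup QB (beta * tB) f).
Proof.
move=> a0 b0; have at0 : 0 <= alpha * tA by rewrite mulr_ge0.
have bt0 : 0 <= beta * tB by rewrite mulr_ge0// ltW.
set g := semigroup QB (beta * tB) f.
have := inner_sub_semigroup_split Alin Asym Aneg g (f - g) at0.
rewrite addrC subrK => /le_trans; apply.
rewrite -(mulrA 2); apply: lerD; rewrite ler_pM2l//.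
  apply: (le_trans (inner_sub_semigroup_le_energy Alin Asym Aneg g at0)).
  exact: energy_smoothed.
apply: (le_trans (inner_sub_semigroup_le Alin Asym Aneg _ _)).
exact: sub_semigroup_le_inner.
Qed.

End Transfer.

Lemma inner_centered_le (R : realType) (T : finType) (g : T -> bool)
    (f := fun x => (g x)%:R : R) (c := #|T|%:R^-1 * inner f (fun=> 1)) :
  (0 < #|T|)%N ->
  #|T|%:R^-1 * inner (f - (fun=> c)) (f - (fun=> c)) <= 1.
Proof.
move=> T0; have n0 : 0 < #|T|%:R :> R by rewrite ltr0n.
rewrite ler_pdivrMl// mulr1.
apply: (@le_trans _ _ (inner f f)); last first.
  rewrite -sum1_card natr_sum; apply: ler_sum => x _.
  by rewrite /f; case: (g x); rewrite ?mulr1 ?mulr0.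
have fc (h : T -> R) : inner h (fun=> c) = c * inner h (fun=> 1).
  rewrite -innerZr; congr inner; apply/funext => x.
  by rewrite !fctE; exact/esym/mulr1.
have fc1 : inner (fun _ : T => c) (fun=> 1) = c * #|T|%:R.
  rewrite innerC fc /inner; congr (_ * _).
  by rewrite -sum1_card natr_sum; apply: eq_bigr => x _; rewrite mulr1.
rewrite !(innerDl, innerDr, innerNl, innerNr) [inner (fun=> c) f]innerC !fc fc1.
have -> : inner f (fun=> 1) = #|T|%:R * c by rewrite /c mulVKf// gt_eqF.
have := sqr_ge0 c; move: (inner f f) => s; nra.
Qed.

Lemma inner_boolean_le (R : realType) (T : finType) (g : T -> bool)
    (f := fun x => (g x)%:R : R) : (0 < #|T|)%N -> #|T|%:R^-1 * inner f f <= 1.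
Proof.
move=> T0; rewrite ler_pdivrMl ?ltr0n// mulr1 -sum1_card natr_sum.
by apply: ler_sum => x _; rewrite /f; case: (g x); rewrite ?mulr1 ?mulr0.
Qed.

Section Sequences.
Variables (R : realType) (Omega : nat -> finType).
Variables (QA QB : forall n, (Omega n -> R) -> Omega n -> R).
Arguments QA : clear implicits.
Arguments QB : clear implicits.
Hypothesis Omega_gt0 : forall n, (0 < #|Omega n|)%N.
Hypotheses (Alin : forall n, linear (QA n)) (Asym : forall n, self_adjoint (QA n))
  (A1 : forall n, QA n (fun=> 1) = 0) (Aneg : forall n f, 0 <= energy (QA n) f).
Hypotheses (Blin : forall n, linear (QB n)) (Bsym : forall n, self_adjoint (QB n))
  (B1 : forall n, QB n (fun=> 1) = 0) (Bneg : forall n f, 0 <= energy (QB n) f).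
Local Notation tA n := (relaxation_time (QA n)).
Local Notation tB n := (relaxation_time (QB n)).
Variable C : R.
Hypothesis C0 : 0 <= C.
Hypothesis AB : forall n f, tA n * energy (QA n) f
  <= C * (tB n * energy (QB n) f).
Variables (X : forall n, markov_chain (QA n) (@uniform_law R (Omega n))).
Variables (Y : forall n, markov_chain (QB n) (@uniform_law R (Omega n))).
Variable g : forall n, Omega n -> bool.
Arguments g : clear implicits.

Let f n : Omega n -> R := fun x => (g n x)%:R.
Arguments f : clear implicits.
Let f0 n : Omega n -> R := f n - (fun=> #|Omega n|%:R^-1 * inner (f n) (fun=> 1)).
Arguments f0 : clear implicits.

Let time_ge0 n (Q : (Omega n -> R) -> Omega n -> R) alpha :
  0 <= alpha -> 0 <= alpha * relaxation_time Q.
Proof. by move=> a0; rewrite mulr_ge0// relaxation_time_ge0. Qed.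

(** [sensitivity_transfer] for a fixed eps: eta bounds the Young error by eps/4,
    then beta bounds the smoothing error by eps/4, and n is taken large enough
    for the sensitivity of the first chain at time 2 beta to bound the rest. *)
Lemma noise_sensitive_comparison : noise_sensitive X g -> noise_sensitive Y g.
Proof.
move=> sensX alpha a0.
have covA n a : 0 <= a -> covariance (mc_prob (X n))
    (fun w => (g n (X n 0 w))%:R) (fun w => (g n (X n (a * tA n) w))%:R)
    = (#|Omega n|%:R^-1
       * inner (f0 n) (semigroup (QA n) (a * tA n) (f0 n)))%:E.
  move=> a0'; rewrite (covariance_chain (@Alin n) (@Asym n) (A1 n))//.
  exact: time_ge0.
have covB n a : 0 <= a -> covariance (mc_prob (Y n))
    (fun w => (g n (Y n 0 w))%:R) (fun w => (g n (Y n (a * tB n) w))%:R)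
    = (#|Omega n|%:R^-1
       * inner (f0 n) (semigroup (QB n) (a * tB n) (f0 n)))%:E.
  move=> a0'; rewrite (covariance_chain (@Blin n) (@Bsym n) (B1 n))//.
  exact: time_ge0.
under eq_fun do rewrite covB ?(ltW a0)//.
apply/fine_cvgP; split; first exact: nearW.
apply/cvgr0Pnorm_le => eps eps0.
pose eta := eps / 4; have eta0 : 0 < eta by rewrite divr_gt0.
pose beta := alpha * eta * eps / (2 * (C + 1)).
have C1 : 0 < C + 1 by rewrite ltr_wpDl.
have beta0 : 0 < beta by rewrite divr_gt0 ?mulr_gt0.
have beta20 : 0 < 2 * beta by rewrite mulr_gt0.
have := sensX (2 * beta) beta20.
under eq_fun do rewrite covA ?(ltW beta20)//.
move=> /fine_cvgP[_] /cvgr0Pnorm_le/(_ (eps * eta)).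
have ee : 0 < eps * eta by rewrite mulr_gt0.
move=> /(_ ee); apply: filterS => n /=.
have n0 : 0 < #|Omega n|%:R :> R by rewrite ltr0n.
have pos : 0 <= inner (f0 n) (semigroup (QB n) (alpha * tB n) (f0 n)).
  have := inner_semigroup_double (@Blin n) (@Bsym n) (Bneg (n:=n))
    (alpha * tB n / 2) (f0 n).
  by rewrite mulrC divfK// => ->; exact: inner_ge0.
move=> small; rewrite ger0_norm; last by rewrite mulr_ge0// invr_ge0 ltW.
have := sensitivity_transfer (@Alin n) (@Asym n) (Aneg (n:=n)) 
  (@Blin n) (@Bsym n) (Bneg (n:=n))
  (relaxation_time_ge0 _) (relaxation_time_ge0 _) C0 (AB (n:=n)) (f0 n) a0 (ltW beta0) eta0.
rewrite -(ler_pM2l (x := #|Omega n|%:R^-1)) ?invr_gt0// => /le_trans; apply.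
have := inner_centered_le R (g n) (Omega_gt0 n).
rewrite -[X in inner X X]/(f0 n) => normf0.
rewrite [2 * (beta * _)]mulrA mulrDr mulrA.
move: (le_trans (ler_norm _) small).
set p := #|Omega n|%:R^-1 * _ => psmall.
rewrite [X in _ + X]mulrCA; set q := #|Omega n|%:R^-1 * _ in normf0 *.
have q0 : 0 <= q by rewrite mulr_ge0 ?inner_ge0// invr_ge0 ltW.
have hp : p / (2 * eta) <= eps / 2.
  rewrite ler_pdivrMr ?mulr_gt0//; apply: (le_trans psmall).
  by rewrite le_eqVlt; apply/orP; left; apply/eqP; field.
have hb : beta * C / (2 * eta * alpha) <= eps / 4.
  rewrite (_ : _ / _ = eps / 4 * (C / (C + 1))); last first.
    by rewrite /beta; field; rewrite !gt_eqF.
  rewrite ler_piMr ?divr_ge0 ?(ltW eps0)// ler_pdivrMr// mul1r lerDl//.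
have hq : (eta + beta * C / (2 * eta * alpha)) * q <= eps / 2.
  apply: (@le_trans _ _ ((eta + beta * C / (2 * eta * alpha)) * 1)).
    apply: ler_wpM2l => //; apply: addr_ge0; first exact: ltW.
    by rewrite divr_ge0// ?(mulr_ge0 (ltW beta0) C0)// ltW// mulr_gt0// mulr_gt0.
  by rewrite mulr1 /eta in hb *; lra.
lra.
Qed.

(** The bound of [stability_transfer] is uniform in n, so it passes to the
    supremum: beta is chosen first from the stability of the second chain, and
    then alpha is small compared to beta. *)
Lemma noise_stable_comparison : noise_stable Y g -> noise_stable X g.
Proof.
move=> stabY.
have disA n a : 0 <= a -> disagreement X g a n
    = (2 * #|Omega n|%:R^-1
       * inner (f n) (f n - semigroup (QA n) (a * tA n) (f n)))%:E.
  move=> a0; rewrite /disagreement.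
  by rewrite (prob_disagreement (@Alin n) (@Asym n) (A1 n))//; exact: time_ge0.
have disB n a : 0 <= a -> disagreement Y g a n
    = (2 * #|Omega n|%:R^-1
       * inner (f n) (f n - semigroup (QB n) (a * tB n) (f n)))%:E.
  move=> a0; rewrite /disagreement.
  by rewrite (prob_disagreement (@Blin n) (@Bsym n) (B1 n))//; exact: time_ge0.
have supA_ge0 a : (0 <= ereal_sup (range (disagreement X g a)))%E.
  apply: (@le_trans _ _ (disagreement X g a 0)) => //.
  by apply: ereal_sup_ubound; exists 0%N.
have step eps : 0 < eps -> \forall a \near 0^'+,
    (ereal_sup (range (disagreement X g a)) <= eps%:E)%E.
  move=> eps0.
  have [beta [beta0 betaP]] : exists beta, 0 < beta /\
      (ereal_sup (range (disagreement Y g beta)) <= (eps / 4)%:E)%E.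
    have /fine_cvgP[fin] := stabY.
    move=> /cvgr0Pnorm_le/(_ (eps / 4)); rewrite divr_gt0// => /(_ isT) small.
    have [b [b0 bfin bsmall]] : exists b, [/\ 0 < b,
        ereal_sup (range (disagreement Y g b)) \is a fin_num &
        `|fine (ereal_sup (range (disagreement Y g b)))| <= eps / 4].
      apply: (@filter_ex _ (0^'+ : set_system R)).
      by near=> b; split; near: b => //; exact: nbhs_right_gt.
    exists b; split=> //; rewrite -(fineK bfin) lee_fin.
    exact: le_trans (ler_norm _) bsmall.
  have Cb : 0 < (C + 1) / beta by rewrite divr_gt0// ltr_wpDl.
  near=> a.
  have a0 : 0 < a by near: a; exact: nbhs_right_gt.
  apply: ge_ereal_sup => _ [n _ <-].
  have Bn : (disagreement Y g beta n <= (eps / 4)%:E)%E.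
    by apply: le_trans betaP; apply: ereal_sup_ubound; exists n.
  rewrite disB ?(ltW beta0)// lee_fin in Bn.
  rewrite disA ?(ltW a0)// lee_fin.
  have n0 : 0 < #|Omega n|%:R :> R by rewrite ltr0n.
  have k0 : 0 < 2 * #|Omega n|%:R^-1 :> R by rewrite mulr_gt0 ?invr_gt0.
  have h := stability_transfer (@Alin n) (@Asym n) (Aneg (n:=n)) 
    (@Blin n) (@Bsym n) (Bneg (n:=n))
    (relaxation_time_ge0 _) (relaxation_time_ge0 _) C0 (AB (n:=n)) (f n) (ltW a0) beta0.
  apply: (le_trans (ler_wpM2l (ltW k0) h)).
  have ff := inner_boolean_le R (g n) (Omega_gt0 n).
  rewrite -[X in inner X X]/(f n) in ff.
  move: Bn ff; set D := 2 * _ * inner _ (_ - semigroup (QB n) _ _).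
  set q := _^-1 * _ => Bn ff.
  rewrite [leLHS](_ : _ = 4 * (a * C / beta * q) + 2 * D); last first.
    by rewrite /q /D; ring.
  have q0 : 0 <= q by rewrite mulr_ge0 ?inner_ge0// invr_ge0 ltW.
  have small : a * C / beta <= eps / 8.
    apply: (@le_trans _ _ (a * ((C + 1) / beta))).
      by rewrite -mulrA ler_pM2l// ler_pM2r ?invr_gt0// lerDl.
    rewrite -ler_pdivlMr//; near: a; apply: nbhs_right_ltW.
    by rewrite divr_gt0// divr_gt0//.
  have aq : a * C / beta * q <= eps / 8.
    apply: (le_trans _ small); rewrite ler_piMr// divr_ge0 ?mulr_ge0// ltW//.
  lra.
apply/fine_cvgP; split.
  have := step 1 ltr01; apply: filterS => a le1.
  by rewrite fin_numElt (lt_le_trans _ (supA_ge0 a))//= (le_lt_trans le1)// ltry.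
apply/cvgr0Pnorm_le => eps eps0; have := step eps eps0; apply: filterS => a ale /=.
rewrite ger0_norm ?fine_ge0// -lee_fin fineK//.
by rewrite fin_numElt (lt_le_trans _ (supA_ge0 a))//= (le_lt_trans ale)// ltry.
Unshelve. all: by end_near. Qed.

End Sequences.

(** * The theorem *)

Theorem theorem1p2
  (R : realType) (d : nat) (hd : (0 < d)%N)
  (f : forall N : nat, 'S_N -> bool)
  (lab : forall m : nat, 'I_(m.+1 ^ d) -> torus_vertex m d)
  (hlab : forall m : nat, bijective (lab m))
  (nuK nuT : nat -> R)
  (hnuK : forall m : nat, 0 < nuK m)
  (hnuT : forall m : nat, 0 < nuT m)
  (X : forall m : nat,
     interchange_process (@complete_adj (m.+1 ^ d)) (nuK m))
  (Y : forall m : nat,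
     interchange_process (labelled_torus_adj (lab m)) (nuT m)) :
  (noise_sensitive X (fun m : nat => f (m.+1 ^ d)%N) ->
   noise_sensitive Y (fun m : nat => f (m.+1 ^ d)%N)) /\
  (noise_stable Y (fun m : nat => f (m.+1 ^ d)%N) ->
   noise_stable X (fun m : nat => f (m.+1 ^ d)%N)).
Proof.
have card_gt0 m : (0 < #|'S_(m.+1 ^ d)|)%N by rewrite -cardsT cardG_gt0.
have C0 : 0 <= (48 * d%:R) ^+ 2 :> R by exact: sqr_ge0.
pose Om m : finType := 'S_(m.+1 ^ d).
pose QK m := interchange_generator (@complete_adj (m.+1 ^ d)) (nuK m).
pose QT m := interchange_generator (labelled_torus_adj (lab m)) (nuT m).
have Kneg m g : 0 <= energy (QK m) g.
  apply: interchange_neg; first exact: ltW.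
    exact: complete_adj_sym.
  exact: complete_adj_irr.
have Tneg m g : 0 <= energy (QT m) g.
  apply: interchange_neg; first exact: ltW.
    exact: torus_adj_sym.
  exact: torus_adj_irr.
have KT m g : relaxation_time (QK m) * energy (QK m) g
    <= (48 * d%:R) ^+ 2 * (relaxation_time (QT m) * energy (QT m) g).
  by have [pos labK posK] := hlab m; exact: energy_comparison.
have Klin m : linear (QK m) by exact: interchange_linear.
have Ksym m : self_adjoint (QK m) by exact: interchange_sym.
have K1 m : QK m (fun=> 1) = 0 by exact: interchange_const.
have Tlin m : linear (QT m) by exact: interchange_linear.
have Tsym m : self_adjoint (QT m) by exact: interchange_sym.
have T1 m : QT m (fun=> 1) = 0 by exact: interchange_const.
split.
  exact: (@noise_sensitive_comparison R Om QK QT card_gt0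
    Klin Ksym K1 Kneg Tlin Tsym T1 Tneg _ C0 KT X Y).
exact: (@noise_stable_comparison R Om QK QT card_gt0
  Klin Ksym K1 Kneg Tlin Tsym T1 Tneg _ C0 KT X Y).
Qed.
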